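(* Let $p$ be a prime, $\mathbb K=\mathbb C_p$, let $\mathbb F$ be the residue field of $\mathbb C_p$, and let $\pi\in\mathbb K$ satisfy $\pi^{p-1}=-p$. For each $A\in\mathrm{BH}_n(\mathbb F)$, the Frobenius endomorphism $$\mathrm{Fr}_A=\left((\Theta_A''\Theta_A')\otimes\mathrm{Id}_{\bigwedge(\mathbb K^n)}\right)p^{Q_A+Q_A^\vee}$$ of $\mathcal B_A^\dagger(\mathbb K)$ is a chain map (i.e. it commutes with $d_A+d_A^\vee$), and $$\Delta^A\,\mathrm{Fr}_A=\mathrm{Fr}_{A^T}\,\Delta^A\,p^{2\,\mathrm{ext}-n}\,p^{-2\widehat Q_A}\,p^{2Q_A^\vee}$$ as maps $\mathcal C_A^\dagger(\mathbb K)\to\mathcal C_{A^T}^\dagger(\mathbb K)$.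
   Context: Conventions. Vectors are row vectors, $e_i$ is the $i$-th standard basis vector, $A^{-T}=(A^T)^{-1}$, and $x^v=x_1^{v_1}\cdots x_n^{v_n}$. $\mathrm{GL}_n(\mathbb Z_{\ge0})$ is the set of $n\times n$ matrices with entries in $\mathbb Z_{\ge 0}$ and nonzero determinant; for such $A$, $W_A(x)=\sum_{i=1}^n x^{e_iA}=\sum_i\prod_j x_j^{A_{ij}}$. $A\in\mathrm{BH}_n(\mathbb F)$ means that $W_A$ is quasi-homogeneous and $(\partial_1W_A,\dots,\partial_nW_A)$ is a regular sequence in $\mathbb F[x_1,\dots,x_n]$. Standing assumption: $\mathrm{char}\,\mathbb F=0$ or $\mathrm{char}\,\mathbb F>|\det A|$ (so here $p>|\det A|$). If $A\in\mathrm{BH}_n(\mathbb F)$ then $A^T\in\mathrm{BH}_n(\mathbb F)$. Exterior operators. $\bigwedge(\mathbb K^n)$ is the exterior algebra on $e_1,\dots,e_n$; $e_i$ also denotes left multiplication by $e_i$ and $e_i^\vee$ contraction, so $e_ie_j^\vee+e_j^\vee e_i=\delta_{ij}$. For $I\in\{0,1\}^n$, $e^I=e_1^{I_1}\cdots e_n^{I_n}$. $\mathrm{ext}=\sum_ie_ie_i^\vee$ is the exterior degree operator. Set $E_{A,i}=\pi\sum_j A_{ij}e_j$ and $E_{A,i}^\vee=\pi^{-1}\sum_j (A^{-1})_{ji}e_j^\vee$. The linear automorphism $*^A$ of $\bigwedge(\mathbb K^n)$ is $*^A(e_{i_1}\cdots e_{i_k})=E_{A^T,i_1}^\vee\cdots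 E_{A^T,i_k}^\vee(E_{A^T,1}\cdots E_{A^T,n})$. Complexes. $\widetilde{\mathcal R}_A^\dagger(\mathbb K)$ is the ring of series $\sum_{\gamma,\lambda\in\mathbb Z_{\ge0}^n}a_{\gamma,\lambda}x^\gamma y^\lambda$ ($a_{\gamma,\lambda}\in\mathbb K$), supported on $(\gamma,\lambda)$ with $(\lambda A^{-T})_i\ge0$ for all $i$, which are overconvergent: there is $M>0$ with $\mathrm{ord}_p(a_{\gamma,\lambda})\ge M(|\gamma|+|\lambda|)$ for all but finitely many $(\gamma,\lambda)$. $\mathcal R_A^\dagger(\mathbb K)$ is its quotient by the ideal of series supported on monomials with $\gamma A^{-1}\lambda^T>0$. On $\mathcal R_A^\dagger(\mathbb K)$ define (extended coefficientwise) $\theta_{A,i}(x^\gamma y^\lambda)=\gamma_ix^\gamma y^\lambda$, $T_{A,i}^\vee(x^\gamma y^\lambda)=\pi^{-1}(\lambda A^{-T})_ix^\gamma y^\lambda$, $\psi_{A,i}^\vee(x^\gamma y^\lambda)=x^\gamma y^{\lambda+e_iA^T}$, $\varphi_{A,i}(x^\gamma y^\lambda)=\pi\sum_jA_{ji}x^{\gamma+e_jA}y^\lambda$. On $\mathcal R_A^\dagger(\mathbb K)\otimes\bigwedge(\mathbb K^n)$ set $d_A=\sum_i(\theta_{A,i}+\varphi_{A,i})e_i$ and $d_A^\vee=\sum_i(T_{A,i}^\vee+\psi_{A,i}^\vee)e_i^\vee$; then $\mathcal B_A^\dagger(\mathbb K)=(\mathcal R_A^\dagger(\mathbb K)\otimes\bigwedge(\mathbb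 K^n),d_A+d_A^\vee)$ is a complex. $\mathcal S_A^\dagger(\mathbb K)\subseteq\mathcal R_A^\dagger(\mathbb K)$ consists of the series supported on monomials with $(\gamma A^{-1})_i\ge0$ for all $i$, and $\mathcal C_A^\dagger(\mathbb K)\subseteq\mathcal B_A^\dagger(\mathbb K)$ is the subcomplex $\mathcal S_A^\dagger(\mathbb K)\otimes\bigwedge(\mathbb K^n)$. Duality. $D^A:\mathcal S_A^\dagger(\mathbb K)\to\mathcal S_{A^T}^\dagger(\mathbb K)$, $D^A(x^\gamma y^\lambda)=x^\lambda y^\gamma$; $\Delta^A=D^A\otimes *^A$. Diagonal operators. $P_{A,i}^\vee(x^\gamma y^\lambda)=0$ if $(\lambda A^{-T})_i=0$ and $=x^\gamma y^\lambda$ otherwise; $Q_A^\vee=\sum_iP_{A,i}^\vee e_i^\vee e_i$, $Q_A=\sum_ie_ie_i^\vee+Q_A^\vee$. On $\mathcal S_A^\dagger(\mathbb K)$, $\widehat P_{A,i}(x^\gamma y^\lambda)=0$ if $(\gamma A^{-1})_i=0$ and $=x^\gamma y^\lambda$ otherwise; $\widehat Q_A=\sum_i\widehat P_{A,i}E_{A,i}E_{A,i}^\vee$. All of these are diagonalizable with integer eigenvalues, and for such an operator $Q$, $p^{Q}$ acts on an eigenvector of eigenvalue $\xi$ by $p^{\xi}$. Frobenius. $\Theta_A':\mathcal R_A^\dagger(\mathbb K)\to\mathcal R_{pA}^\dagger(\mathbb K)$, $\Theta_A'(x^\gamma y^\lambda)=x^{p\gamma}y^{p\lambda}$; $\Theta_A'':\mathcal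 R_{pA}^\dagger(\mathbb K)\to\mathcal R_A^\dagger(\mathbb K)$ is multiplication by $Z_A(x)Z_{A^T}(y)$, where $Z_A(x)=\exp(\pi(W_{pA}(x)-W_A(x)))$ (an overconvergent series). *)

(* Defs.v *)
From HB Require Import structures.
From mathcomp Require Import all_boot all_order all_algebra.
From mathcomp Require Import mpoly.
From mathcomp Require Import zify.
From mathcomp Require Import functions reals constructive_ereal.

Set Implicit Arguments.
Unset Strict Implicit.
Unset Printing Implicit Defensive.

Import Order.TTheory GRing.Theory Num.Theory.

Local Open Scope ring_scope.

(* MathComp has no p-adic numbers, so C_p enters through its definition: an
   algebraically closed field, complete for a valuation ord extending the
   p-adic one, in which the algebraic closure of Q_p is dense.  This determines
   (K, ord) up to isometric isomorphism. *)

Section ComplexPadic.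
Variables (p : nat) (R : realType) (K : closedFieldType) (ord : K -> \bar R).

Definition ord_ge (N : nat) (x : K) : Prop := (N%:R%:E <= ord x)%E.

(* Q_p, as the closure of Q in K *)
Definition in_Qp (x : K) : Prop :=
  forall N : nat, exists q : rat, ord_ge N (x - ratr q).

Definition algebraic_over_Qp (x : K) : Prop :=
  exists P : {poly K}, [/\ P != 0, forall i, in_Qp P`_i & root P x].

(* The value -oo is never taken: the axioms force ord 1 = 0, hence
   ord x + ord x^-1 = 0 for x != 0, whereas -oo is absorbing. *)
Record is_Cp : Prop := IsCp {
  ord_eqy : forall x, ord x = +oo%E <-> x = 0;
  ordM : forall x y, ord (x * y) = (ord x + ord y)%E;
  ordD : forall x y, (Order.min (ord x) (ord y) <= ord (x + y))%E;
  ord_p : ord p%:R = 1%:E;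
  Cp_complete : forall u : nat -> K,
    (forall N, exists n0, forall i j,
        (n0 <= i)%N -> (n0 <= j)%N -> ord_ge N (u i - u j)) ->
    exists l, forall N, exists n0, forall i, (n0 <= i)%N -> ord_ge N (u i - l);
  Qpbar_dense : forall x N, exists2 y, algebraic_over_Qp y & ord_ge N (x - y)
}.

(* F is the residue field of K, with reduction map red; red is only meaningful
   on the valuation ring {x | 0 <= ord x}. *)
Record is_residue_field (F : fieldType) (red : K -> F) : Prop :=
  IsResidueField {
  red1 : red 1 = 1;
  redD : forall x y, (0 <= ord x)%E -> (0 <= ord y)%E ->
    red (x + y) = red x + red y;
  redM : forall x y, (0 <= ord x)%E -> (0 <= ord y)%E ->
    red (x * y) = red x * red y;
  red_surj : forall a, exists2 x, (0 <= ord x)%E & red x = a;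
  red_eq0 : forall x, (0 <= ord x)%E -> red x = 0 <-> (0 < ord x)%E
}.

End ComplexPadic.

Section BerglundHubsch.
Variable n : nat.
Implicit Types A : 'M[nat]_n.

Definition mrow A (i : 'I_n) : 'X_{1..n} := [multinom A i j | j < n].

Definition W (S : comNzRingType) A : {mpoly S[n]} := \sum_(i < n) 'X_[mrow A i].

Definition quasi_homogeneous (S : comNzRingType) (f : {mpoly S[n]}) : Prop :=
  exists (q : 'I_n -> nat) (d : nat),
    [/\ forall i, (0 < q i)%N, (0 < d)%N &
        forall m, m \in msupp f -> (\sum_(i < n) q i * m i)%N = d].

(* g lies in the ideal generated by f_0, ..., f_{k-1} *)
Definition in_ideal (S : comNzRingType) (f : 'I_n -> S) (k : nat) (g : S) :
    Prop :=
  exists c : 'I_n -> S, g = \sum_(j < n | (j < k)%N) c j * f j.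

Definition regular_sequence (S : comNzRingType) (f : 'I_n -> S) : Prop :=
  (forall (i : 'I_n) (g : S), in_ideal f i (f i * g) -> in_ideal f i g)
  /\ ~ in_ideal f n 1.

Definition zdet A : int := \det (map_mx (fun k : nat => k%:Z) A).

Definition BH (F : fieldType) A : Prop :=
  [/\ zdet A != 0, quasi_homogeneous (W F A) &
      regular_sequence (fun i => (W F A)^`M(i))].

Definition ratmx A : 'M[rat]_n := map_mx (fun k : nat => k%:R) A.

Definition ratrv (m : 'X_{1..n}) : 'rV[rat]_n := \row_j (m j)%:R.

End BerglundHubsch.

(* p^Q for an operator Q on V which is diagonalizable with integer eigenvalues
   of absolute value at most N.  The summand of index x is p^x times the
   projection onto the x-eigenspace, written as the product over y != x of
   (Q - y) / (x - y); see ppow_eigen. *)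
Section PowerOfOperator.
Variables (p N : nat) (K : fieldType) (V : lmodType K).

Definition int_range : seq int := [seq k%:Z - N%:Z | k <- iota 0 (2 * N).+1].

Definition eigenproj (Q : V -> V) (x : int) (v : V) : V :=
  foldr (fun y w =>
    if y == x then w else ((x - y)%:~R)^-1 *: (Q w - y%:~R *: w)) v int_range.

Definition ppow (Q : V -> V) (v : V) : V :=
  \sum_(x <- int_range) p%:R ^ x *: eigenproj Q x v.

Lemma mem_int_range x : (x \in int_range) = (`|x| <= N)%N.
Proof.
apply/mapP/idP => [[k]|xN].
  by rewrite mem_iota => /andP[_ kN] ->; lia.
exists (absz (x + N%:Z)); last by lia.
by rewrite mem_iota; lia.
Qed.

Lemma int_range_uniq : uniq int_range.
Proof. by rewrite map_inj_uniq ?iota_uniq // => a b; lia. Qed.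

Lemma ppow_eigen (Q : V -> V) (xi : int) (v : V) :
  [pchar K] =i pred0 ->
  (forall c w, Q (c *: w) = c *: Q w) -> (`|xi| <= N)%N ->
  Q v = xi%:~R *: v -> ppow Q v = p%:R ^ xi *: v.
Proof.
move=> K0 QZ xiN Qv.
have ev (x : int) (s : seq int) : exists c, foldr (fun (y : int) w =>
    if y == x then w else ((x - y)%:~R)^-1 *: (Q w - y%:~R *: w)) v s = c *: v /\
    (x != xi -> xi \in s -> c = 0) /\ (x = xi -> c = 1).
  elim: s => [|y s [c [/= -> [c0 c1]]]]; first by exists 1; rewrite scale1r.
  case: eqVneq => [->|yx].
    exists c; split=> //; split=> // xxi; rewrite inE eq_sym (negPf xxi).
    exact: c0.
  exists ((x - y)%:~R^-1 * (c * xi%:~R - y%:~R * c)).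
  rewrite QZ Qv !scalerA -scalerBl scalerA; split=> //; split.
    move=> xxi; rewrite inE => /predU1P[->|xis].
      by rewrite [c * _]mulrC subrr mulr0.
    by rewrite c0 // mul0r !mulr0 subrr mulr0.
  move=> xxi; rewrite xxi c1 // mul1r mulr1 -intrB mulVf // -xxi.
  have natK := (pcharf0P K).1 K0.
  case: (x - y) (subr_eq0 x y) => k; rewrite [x == y]eq_sym (negPf yx).
    by move=> kN0; rewrite -pmulrn natK; rewrite -eqz_nat kN0.
  by move=> _; rewrite NegzE mulrNz oppr_eq0 -pmulrn natK.
have evN x : exists c, eigenproj Q x v = c *: v /\
    (x != xi -> xi \in int_range -> c = 0) /\ (x = xi -> c = 1).
  exact: ev x int_range.
rewrite /ppow (bigD1_seq xi) ?mem_int_range ?int_range_uniq //=.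
have [c [-> [_ ->//]]] := evN xi; rewrite scale1r.
rewrite big1_seq ?addr0 // => x /andP[xxi _].
have [c' [-> [c0 _]]] := evN x.
by rewrite c0 ?mem_int_range // scale0r scaler0.
Qed.

End PowerOfOperator.

(* V (x) /\(K^n): the coordinate at I of an element is its component on
   e^I, the product of the e_i, i in I, in increasing order. *)
Definition extp (n : nat) (K : fieldType) (V : lmodType K) : Type :=
  {ffun {set 'I_n} -> V}.
HB.instance Definition _ n (K : fieldType) (V : lmodType K) :=
  GRing.Lmodule.on (extp n V).

Section Exterior.
Variables (n : nat) (K : fieldType) (V : lmodType K).
Implicit Types (i : 'I_n) (w : extp n V).

Definition esign i (I : {set 'I_n}) : K := (-1) ^+ #|[set j in I | (j < i)%N]|.

Definition wedge i w : extp n V :=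
  [ffun I : {set 'I_n} => if i \in I then esign i I *: w (I :\ i) else 0].

Definition contract i w : extp n V :=
  [ffun I : {set 'I_n} => if i \in I then 0 else esign i I *: w (i |: I)].

(* T (x) Id *)
Definition lift (T : V -> V) w : extp n V := [ffun I : {set 'I_n} => T (w I)].

(* v (x) 1 *)
Definition vac (v : V) : extp n V :=
  [ffun I : {set 'I_n} => if I == set0 then v else 0].

Definition extdeg w : extp n V := \sum_(i < n) wedge i (contract i w).

Lemma esignD1 i j (I : {set 'I_n}) : j \in I ->
  esign i I = (-1) ^+ (j < i)%N * esign i (I :\ j).
Proof.
move=> jI; rewrite /esign -exprD; congr (_ ^+ _).
rewrite (cardsD1 j) inE jI /=; congr (_ + #|pred_of_set _|)%N.
by apply/setP=> k; rewrite !inE andbA.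
Qed.

Lemma wedge_contract i j w :
  wedge i (contract j w) + contract j (wedge i w) = if i == j then w else 0.
Proof.
apply/ffunP=> I; rewrite !ffunE; case: eqVneq => [<-|ij].
  case: ifPn => iI.
    rewrite setD11 setD1K // addr0 scalerA (esignD1 i iI) ltnn mul1r.
    by rewrite -expr2 sqrr_sign scale1r.
  rewrite setU11 setU1K // add0r scalerA (esignD1 i (setU11 i I)) ltnn mul1r.
  by rewrite setU1K // -expr2 sqrr_sign scale1r.
rewrite !inE (negPf ij) [j == i]eq_sym (negPf ij) /=.
have -> : (0 : extp n V) I = 0 by exact: ffunE.
case: (boolP (j \in I)) => jI /=.
  by case: ifP => _; rewrite ?scaler0 addr0.
case: ifPn => iI; last by rewrite scaler0 addr0.
have -> : (j |: I) :\ i = j |: (I :\ i).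
  by apply/setP=> k; rewrite !inE; case: eqVneq => [->|//]; rewrite (negPf ij).
rewrite !scalerA -scalerDl (esignD1 j iI) (esignD1 i (setU11 j I)) setU1K //.
have -> : esign i I * esign j (I :\ i)
    + (-1) ^+ (i < j)%N * esign j (I :\ i) * ((-1) ^+ (j < i)%N * esign i I)
  = ((-1) ^+ (i < j)%N * (-1) ^+ (j < i)%N + 1) * (esign i I * esign j (I :\ i)).
  by rewrite mulrDl mul1r addrC mulrACA [esign j _ * _]mulrC.
have : (i < j)%N (+) (j < i)%N.
  by case: ltngtP ij => // /val_inj->; rewrite eqxx.
by rewrite -signr_addb => ->; rewrite expr1 addNr mul0r scale0r.
Qed.

Variable pi : K.
Implicit Type A : 'M[nat]_n.

Definition bigE A i w : extp n V :=
  pi *: \sum_(j < n) (A i j)%:R *: wedge j w.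

Definition bigEv A i w : extp n V :=
  pi^-1 *: \sum_(j < n) ratr (invmx (ratmx A) j i) *: contract j w.

(* Id (x) *^A *)
Definition star A w : extp n V :=
  \sum_(I : {set 'I_n})
     foldr (bigEv A^T) (foldr (bigE A^T) (vac (w I)) (enum 'I_n)) (enum I).

End Exterior.

(* (g, l) stands for the monomial x^g y^l *)
Definition mono (n : nat) : Type := ('X_{1..n} * 'X_{1..n})%type.

(* Formal series; m is sent to the coefficient of the monomial m. *)
Definition series (n : nat) (K : fieldType) : Type := mono n -> K^o.
HB.instance Definition _ n (K : fieldType) := GRing.Lmodule.on (series n K).

(* A subquotient {v | sq_num v} / {v | sq_num v /\ sq_den v} of V. *)
Record subquotient (V : zmodType) : Type := Subquotient {
  sq_num : V -> Prop;
  sq_den : V -> Prop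
}.

Definition induces (V V' : zmodType) (X : subquotient V) (Y : subquotient V')
    (T : V -> V') : Prop :=
  (forall v, sq_num X v -> sq_num Y (T v)) /\
  (forall v v', sq_num X v -> sq_num X v' -> sq_den X (v - v') ->
     sq_den Y (T v - T v')).

Definition same_induced_map (V V' : zmodType) (X : subquotient V)
    (Y : subquotient V') (T T' : V -> V') : Prop :=
  [/\ induces X Y T, induces X Y T' &
      forall v, sq_num X v -> sq_den Y (T v - T' v)].

Section Complexes.
Variables (p : nat) (R : realType) (K : closedFieldType) (ord : K -> \bar R).
Variables (pi : K) (n : nat).
Implicit Types (A : 'M[nat]_n) (i : 'I_n) (f : series n K) (m : mono n).
Implicit Type w : extp n (series n K).

(* g A^-1, l A^-T and g A^-1 l^T for m = (g, l) *)
Definition xwt A m : 'rV[rat]_n := ratrv m.1 *m invmx (ratmx A).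
Definition ywt A m : 'rV[rat]_n := ratrv m.2 *m invmx (ratmx A)^T.
Definition xywt A m : rat := (xwt A m *m (ratrv m.2)^T) 0 0.

Definition supported (P : mono n -> Prop) f : Prop := forall m, f m != 0 -> P m.

Definition overconvergent f : Prop :=
  exists2 M : R, 0 < M & exists s : seq (mono n), forall m, m \notin s ->
    ((M * (mdeg m.1 + mdeg m.2)%:R)%:E <= ord (f m))%E.

Definition Rtilde A f : Prop :=
  supported (fun m => forall i, 0 <= ywt A m 0 i) f /\ overconvergent f.

Definition Rideal A f : Prop :=
  Rtilde A f /\ supported (fun m => 0 < xywt A m) f.

Definition Stilde A f : Prop :=
  Rtilde A f /\ supported (fun m => forall i, 0 <= xwt A m 0 i) f.

(* B_A and C_A *)
Definition Bcx A : subquotient (extp n (series n K)) :=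
  Subquotient (fun w => forall I : {set 'I_n}, Rtilde A (w I))
              (fun w => forall I : {set 'I_n}, Rideal A (w I)).

Definition Ccx A : subquotient (extp n (series n K)) :=
  Subquotient (fun w => forall I : {set 'I_n}, Stilde A (w I))
              (fun w => forall I : {set 'I_n}, Rideal A (w I)).

(* multiplication by the monomial u *)
Definition mshift (u : mono n) f : series n K := fun m =>
  if (u.1 <= m.1)%MM && (u.2 <= m.2)%MM
  then f ((m.1 - u.1)%MM, (m.2 - u.2)%MM) else 0.

Definition theta i f : series n K := fun m => (m.1 i)%:R * f m.

Definition Tv A i f : series n K :=
  fun m => pi^-1 * ratr (ywt A m 0 i) * f m.

Definition psiv A i f : series n K := mshift (0%MM, mrow A^T i) f.

Definition phi A i f : series n K :=
  pi *: \sum_(j < n) (A j i)%:R *: mshift (mrow A j, 0%MM) f.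

Definition dA A w : extp n (series n K) :=
  \sum_(i < n) lift (fun f => theta i f + phi A i f) (wedge i w).

Definition dAv A w : extp n (series n K) :=
  \sum_(i < n) lift (fun f => Tv A i f + psiv A i f) (contract i w).

Definition dtot A w : extp n (series n K) := dA A w + dAv A w.

Definition Dswap f : series n K := fun m => f (m.2, m.1).

Definition Delta A w : extp n (series n K) := star pi A (lift Dswap w).

Definition Pv A i f : series n K :=
  fun m => if ywt A m 0 i == 0 then 0 else f m.

Definition Qv A w : extp n (series n K) :=
  \sum_(i < n) lift (Pv A i) (contract i (wedge i w)).

Definition QA A w : extp n (series n K) := extdeg w + Qv A w.

Definition Phat A i f : series n K :=
  fun m => if xwt A m 0 i == 0 then 0 else f m.

Definition Qhat A w : extp n (series n K) :=
  \sum_(i < n) lift (Phat A i) (bigE pi A i (bigEv pi A i w)).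

(* exp of a polynomial g with zero constant term; the terms with k > mdeg m
   do not contribute to the coefficient of m *)
Definition mexp (g : {mpoly K[n]}) (m : 'X_{1..n}) : K :=
  \sum_(k < (mdeg m).+1) (g ^+ k)@_m / (k`!)%:R.

Definition Z A (m : 'X_{1..n}) : K := mexp (pi *: (W K (A *+ p) - W K A)) m.

Definition Theta1 f : series n K := fun m =>
  if [forall j, (p %| m.1 j)%N && (p %| m.2 j)%N]
  then f ([multinom (m.1 j %/ p)%N | j < n], [multinom (m.2 j %/ p)%N | j < n])
  else 0.

Definition Theta2 A f : series n K := fun m =>
  \sum_(u : 'X_{1..n < (mdeg m.1).+1} | (u <= m.1)%MM)
  \sum_(v : 'X_{1..n < (mdeg m.2).+1} | (v <= m.2)%MM)
     Z A u * Z A^T v * f ((m.1 - u)%MM, (m.2 - v)%MM).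

(* All the operators to which this is applied below (QA + Qv, 2 ext - n,
   -2 Qhat and 2 Qv) have their eigenvalues in [-2n, 2n]. *)
Definition pexp (Q : extp n (series n K) -> extp n (series n K)) w :
    extp n (series n K) := ppow p (2 * n) Q w.

Definition Fr A w : extp n (series n K) :=
  lift (fun f => Theta2 A (Theta1 f)) (pexp (fun w => QA A w + Qv A w) w).

End Complexes.

(* Main.v *)
(** Everything is read off coefficientwise.  Write q(I,m) = |I| + 2 #{i notin I |
    ywt_i(m) <> 0} for the exponent of p in Fr_A at x^g y^l e^I, and Theta for
    Theta_A'' Theta_A'.  The differential equations
    x_i d/dx_i Z_A = pi sum_j A_ji (p x^(p r_j) - x^(r_j)) Z_A (r_j the rows of A)
    give (theta_i + phi_i) Theta = p Theta (theta_i + phi_i), and, after exchanging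
    the roles of x and y, (T_i + psi_i) Theta = p Theta (T_i + psi_i).  On the other
    hand (T_i + psi_i) e_i^v raises q by exactly one, and so does (theta_i + phi_i) e_i
    except at monomials with ywt_i <> 0, where its image lies in the ideal; hence Fr_A
    is a chain map.

    The map *^A carries e_i, e_i^v, E_(A,i), E_(A,i)^v to E_(A^T,i)^v, E_(A^T,i), e_i^v,
    e_i.  So Delta^A exchanges ext with n - ext and \hat Q_A with Q_(A^T)^v, and the
    second identity holds exactly, before passing to the quotient, by comparing
    exponents of p.

    Overconvergence of Z_A reduces to that of exp(pi (z^p - z)).  Since pi^p / p = - pi,
    this series is (1 - pi z) prod_(k <> 1, p) exp(pi^k z^k / k), and the factors with
    k <> 1, p already converge on a disc of radius > 1 by Legendre's bound on k!. *)

Require Import Defs.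
From HB Require Import structures.
From mathcomp Require Import all_boot all_order all_algebra.
From mathcomp Require Import mpoly.
From mathcomp Require Import zify ring lra.
From mathcomp Require Import functions reals constructive_ereal.

Set Implicit Arguments.
Unset Strict Implicit.
Unset Printing Implicit Defensive.

Import Order.TTheory GRing.Theory Num.Theory.

Local Open Scope ring_scope.

(* These names are hidden by constructive_ereal and fintype. *)
Local Notation contract := Defs.contract.
Local Notation lift := Defs.lift.

(** * Valuations of natural numbers and factorials *)

(** The operators act on arbitrary formal series, so the rules for Theta and the duality identity
    are formal; convergence enters only when maps descend to the subquotients. There each space is
    given by overconvergence and a support condition, and each of the three sets of monomials
    involved is stable under translation by [Smono], which contains the exponents of Z_A(x)
    Z_(A^T)(y) and the monomials of phi and psi.

    The exponent q works as follows. Adding i to I gains 1 from |I| and loses 2 exactly when ywt_i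
    <> 0. In that bad case the image of (theta_i + phi_i) e_i vanishes at exponents with g_i = 0,
    and g_i <> 0 puts the monomial in the ideal, since g A^-1 l^T = sum_i g_i ywt_i has nonnegative
    terms. Removing i loses 1 and gains 2 when ywt_i <> 0, and this is the only case that counts:
    T_i vanishes where ywt_i = 0, and psi_i makes ywt_i positive.

    In the duality, \hat Q_A mixes the basis vectors e^I. Its power is therefore never computed on
    the source: it is carried through Delta^A, and all exponents are compared on the target. *)

Section Valuation.
Variables (p : nat) (R : realType) (K : closedFieldType) (ord : K -> \bar R).
Hypothesis Cp : is_Cp p ord.

Definition vge (r : R) (x : K) : Prop := (r%:E <= ord x)%E.

Lemma ord1 : ord 1 = 0%:E.
Proof.
have := ordM Cp 1 p%:R; rewrite mul1r (ord_p Cp).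
by case: (ord 1) => [r||] //= [] r1; congr EFin; lra.
Qed.

Lemma ord_fin x : x != 0 -> exists r, ord x = r%:E.
Proof.
move=> x0; have := ordM Cp x x^-1; rewrite mulfV // ord1.
by case: (ord x) => [r||]; [exists r | case: (ord _) | ].
Qed.

Lemma ordV x r : x != 0 -> ord x = r%:E -> ord x^-1 = (- r)%:E.
Proof.
move=> x0 xr; have := ordM Cp x x^-1; rewrite mulfV // ord1 xr.
by case: (ord _) => [s||] //= [] rs; congr EFin; lra.
Qed.

Lemma ordX x r k : ord x = r%:E -> ord (x ^+ k) = (r *+ k)%:E.
Proof.
move=> xr; elim: k => [|k IH]; first by rewrite expr0 ord1.
by rewrite exprS (ordM Cp) xr IH mulrS.
Qed.

Lemma ordN x : ord (- x) = ord x.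
Proof.
have N1 : (-1 : K) != 0 by rewrite oppr_eq0 oner_eq0.
have [r rE] := ord_fin N1.
have r0 : r = 0.
  have := ordX 2 rE; rewrite sqrrN expr1n ord1 => -[].
  by rewrite mulr2n => ?; lra.
by rewrite -mulN1r (ordM Cp) rE r0 add0e.
Qed.

Lemma vge0 r : vge r 0.
Proof. by rewrite /vge; have [_ ->//] := ord_eqy Cp 0; rewrite leey. Qed.

Lemma vge_ord x r s : ord x = r%:E -> s <= r -> vge s x.
Proof. by rewrite /vge => ->; rewrite lee_fin. Qed.

Lemma vgeW r s x : s <= r -> vge r x -> vge s x.
Proof. by move=> sr; apply: le_trans; rewrite lee_fin. Qed.

Lemma vgeD r x y : vge r x -> vge r y -> vge r (x + y).
Proof. by move=> rx ry; apply: le_trans (ordD Cp x y); rewrite le_min rx. Qed.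

Lemma vgeN r x : vge r x -> vge r (- x).
Proof. by rewrite /vge ordN. Qed.

Lemma vgeM r s x y : vge r x -> vge s y -> vge (r + s) (x * y).
Proof. by rewrite /vge (ordM Cp) EFinD; exact: leeD. Qed.

Lemma vgeX r x k : vge r x -> vge (r *+ k) (x ^+ k).
Proof.
move=> rx; elim: k => [|k IH]; first by apply: vge_ord ord1 _; rewrite mulr0n.
by rewrite exprS mulrS; apply: vgeM.
Qed.

Lemma vge_sum (I : Type) (s : seq I) (P : pred I) (F : I -> K) r :
  (forall i, P i -> vge r (F i)) -> vge r (\sum_(i <- s | P i) F i).
Proof.
by move=> rF; elim/big_rec: _ => [|i x Pi]; [exact: vge0 | apply: vgeD; exact: rF].
Qed.

Lemma vge_bound (I : finType) (F : I -> K) :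
  exists2 C : R, 0 <= C & forall i, vge (- C) (F i).
Proof.
have /fin_all_exists[c cF] i : exists c : R, 0 <= c /\ vge (- c) (F i).
  have [->|/ord_fin[r rE]] := eqVneq (F i) 0; first by exists 0; split; last exact: vge0.
  by exists `|r|; split=> //; apply: vge_ord rE _; rewrite lerNl -normrN ler_norm.
exists (\sum_i c i) => [|i]; first by apply: sumr_ge0 => i _; case: (cF i).
apply: vgeW (proj2 (cF i)); rewrite lerN2 (bigD1 i) //= lerDl.
by apply: sumr_ge0 => j _; case: (cF j).
Qed.

Lemma vge_nat k : vge 0 k%:R.
Proof.
elim: k => [|k IH]; first exact: vge0.
by rewrite -natr1; apply: vgeD => //; apply: vge_ord ord1 _.
Qed.

(** Bezout gives a k - b p = 1; if [k%:R] had positive valuation, so would 1, since b p has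
    valuation at least 1. *)
Lemma ord_coprime k : prime p -> coprime p k -> ord k%:R = 0%:E.
Proof.
move=> pp; rewrite coprime_sym => cpk; have p0 := prime_gt0 pp.
have [k0|k0] := posnP k.
  by move: cpk; rewrite k0 /coprime gcd0n => /eqP p1; rewrite p1 in pp.
have [a b E _] := egcdnP p k0; rewrite (eqP cpk) in E.
have {E} K1 : a%:R * k%:R - b%:R * p%:R = 1 :> K.
  by rewrite -!natrM E natrD addrC addKr.
have kpos : ~ vge 1 k%:R -> k%:R != 0 :> K.
  by move=> nk; apply/eqP => kE; apply: nk; rewrite kE; exact: vge0.
have ubnd (e : R) : 0 < e -> e <= 1 -> ~ vge e k%:R.
  move=> e0 e1 ke; have : vge e 1.
    rewrite -K1; apply: vgeD.
      by have := vgeM (vge_nat a) ke; rewrite add0r.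
    apply: vgeN; apply: (@vgeW (0 + 1)); first by rewrite add0r.
    by apply: vgeM (vge_nat b) _; rewrite /vge (ord_p Cp).
  by rewrite /vge ord1 lee_fin leNgt e0.
have [r rE] := ord_fin (kpos (ubnd 1 ltr01 (lexx _))).
rewrite rE; congr EFin; apply/eqP; rewrite eq_le; apply/andP; split; last first.
  by have := vge_nat k; rewrite /vge rE lee_fin.
rewrite leNgt; apply/negP => r0; apply: (ubnd (Num.min r 1)).
- by rewrite lt_min r0 ltr01.
- by rewrite ge_min lexx orbT.
- by apply: vge_ord rE _; rewrite ge_min lexx.
Qed.

Lemma ord_nat k : prime p -> (0 < k)%N -> ord k%:R = (logn p k)%:R%:E.
Proof.
move=> pp k0; have [k' cpk' kE] := pfactor_coprime pp k0.
rewrite {1}kE natrM natrX (ordM Cp) (ord_coprime pp cpk') (ordX _ (ord_p Cp)).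
by rewrite add0e.
Qed.

Lemma Cp_natr_eq0 k : prime p -> (k%:R == 0 :> K) = (k == 0%N).
Proof.
move=> pp; have [->|k0] := posnP k; first by rewrite !eqxx.
apply/eqP => /(ord_eqy Cp _).
by rewrite ord_nat.
Qed.

Lemma Cp_pchar0 : prime p -> [pchar K] =i pred0.
Proof. by move=> pp; apply/pcharf0P => k; exact: Cp_natr_eq0. Qed.

(** Legendre's formula cut off at p^t: the remainder k %/ p^t pays for the next term, because p (k
    %/ p^(t+1)) <= k %/ p^t. *)
Lemma leq_logn_fact k : prime p -> (p.-1 * logn p k`! <= k)%N.
Proof.
move=> pp; rewrite (logn_fact _ pp).
suff H t : (p.-1 * (\sum_(1 <= j < t.+1) k %/ p ^ j) + k %/ p ^ t <= k)%N.
  exact: leq_trans (leq_addr _ _) (H k).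
elim: t => [|t IH]; first by rewrite big_geq // muln0 expn0 divn1.
apply: leq_trans IH; rewrite big_nat_recr //= mulnDr -addnA leq_add2l.
rewrite -mulSnr prednK ?prime_gt0 // expnSr divnMA mulnC.
exact: leq_divM.
Qed.

Lemma vge_invfact k : prime p -> vge (- (k%:R / p.-1%:R)) (k`!%:R)^-1.
Proof.
move=> pp; have f0 := fact_gt0 k.
apply: vge_ord (ordV _ (ord_nat pp f0)) _; first by rewrite Cp_natr_eq0 // -lt0n.
have p1 : 0 < p.-1%:R :> R by rewrite ltr0n; case: p pp => [|[]].
by rewrite lerN2 ler_pdivlMr // -natrM ler_nat mulnC leq_logn_fact.
Qed.

Lemma ord_root pi : prime p -> pi ^+ p.-1 = - p%:R -> ord pi = (p.-1%:R^-1)%:E.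
Proof.
move=> pp piE; have p1 : (0 < p.-1)%N by case: p pp => [|[]].
have pi0 : pi != 0.
  apply: contraTneq isT => pi0; move: piE; rewrite pi0 expr0n gtn_eqF //= => /eqP.
  by rewrite eq_sym oppr_eq0 Cp_natr_eq0 // gtn_eqF // prime_gt0.
have [r rE] := ord_fin pi0.
have := ordX p.-1 rE; rewrite piE ordN (ord_p Cp) rE => -[r1]; congr EFin.
have p10 : p.-1%:R != 0 :> R by rewrite pnatr_eq0 -lt0n.
by apply: (mulIf p10); rewrite mulVf // mulr_natr.
Qed.

End Valuation.

(** * Formal exponentials in several variables *)

Section FormalExponential.
Variables (n : nat) (K : closedFieldType).
Implicit Types (a b f : 'X_{1..n} -> K) (g h P Q : {mpoly K[n]}) (m r : 'X_{1..n}).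
Implicit Type i : 'I_n.

(** The Cauchy product, summed over the same bounded index type as [Theta2], which then becomes two
    nested [conv]. *)
Definition conv a f m : K :=
  \sum_(u : 'X_{1..n < (mdeg m).+1} | (u <= m)%MM) a u * f (m - u)%MM.

Definition shift r f m : K := if (r <= m)%MM then f (m - r)%MM else 0.

Definition trunc d a : {mpoly K[n]} := \sum_(k : 'X_{1..n < d}) a k *: 'X_[k].

(** The operator x_i d/dx_i on coefficients; unlike d/dx_i it leaves exponents in place. *)
Definition euler i a m : K := (m i)%:R * a m.

Definition mcoeffs P m : K := P@_m.

Lemma mdeg_lepm m r : (r <= m)%MM -> (mdeg r <= mdeg m)%N.
Proof. by move=> /submK <-; rewrite mdegD leq_addl. Qed.

Lemma mdeg_subm m r : (r <= m)%MM -> (mdeg r + mdeg (m - r) = mdeg m)%N.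
Proof. by move=> /submK {2}<-; rewrite mdegD addnC. Qed.

Lemma eq_conv_le a a' f f' m :
  (forall k, (k <= m)%MM -> a k = a' k) -> (forall k, (k <= m)%MM -> f k = f' k) ->
  conv a f m = conv a' f' m.
Proof. by move=> aE fE; apply: eq_bigr => u um; rewrite aE ?fE ?lem_subr. Qed.

Lemma conv_mcoeffs P Q m : conv (mcoeffs P) (mcoeffs Q) m = (P * Q)@_m.
Proof. by symmetry; apply: mcoeff_poly_mul_lin. Qed.

(** A coefficient of a Cauchy product at m involves only the divisors of x^m, so polynomials that
    agree there may be substituted. Commutativity, associativity and the Leibniz rule are thus
    inherited from [{mpoly K[n]}]. *)
Lemma convE P Q a f m :
  (forall k, (k <= m)%MM -> P@_k = a k) -> (forall k, (k <= m)%MM -> Q@_k = f k) ->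
  conv a f m = (P * Q)@_m.
Proof. by move=> aE fE; rewrite -conv_mcoeffs; apply: eq_conv_le => k /[dup] km; [move/aE|move/fE]. Qed.

Lemma mcoeff_trunc m a k : (k <= m)%MM -> (trunc (mdeg m).+1 a)@_k = a k.
Proof. by move=> km; rewrite mcoeff_mpoly // ltnS mdeg_lepm. Qed.

Lemma conv_trunc a f m :
  conv a f m = (trunc (mdeg m).+1 a * trunc (mdeg m).+1 f)@_m.
Proof. by apply: convE => k km; rewrite mcoeff_trunc. Qed.

Lemma mcoeffXM r P m : ('X_[r] * P)@_m = shift r (mcoeffs P) m.
Proof.
rewrite /shift; case: ifPn => rm; first by rewrite mulrC -{1}(submK rm) [(_ + r)%MM]addmC mcoeffMX.
apply/eqP; rewrite mcoeff_eq0; apply: contra rm => /msuppM_le.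
by move=> /allpairsP[[u v] /= [+ _ ->]]; rewrite msuppX inE => /eqP ->; exact: lem_addr.
Qed.

Lemma mcoeff_euler i P m : ('X_i * P^`M(i))@_m = euler i (mcoeffs P) m.
Proof.
rewrite mcoeffXM /shift /euler /mcoeffs lep1mP; have [->|mi] := eqVneq; first by rewrite mul0r.
rewrite mcoeff_deriv submK ?lep1mP // mulr_natl; congr (_ *+ _).
by rewrite mnmBE mnm1E eqxx subn1 prednK // lt0n.
Qed.

Lemma convC a f m : conv a f m = conv f a m.
Proof. by rewrite !conv_trunc mulrC. Qed.

Lemma convA a b f m : conv a (conv b f) m = conv (conv a b) f m.
Proof.
set t := trunc (mdeg m).+1.
have tE c k : (k <= m)%MM -> (t c)@_k = c k by exact: mcoeff_trunc.
rewrite (@convE (t a) (t b * t f)) => [||k km]; try by move=> k /tE.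
  rewrite mulrA; symmetry; apply: convE => k km; rewrite ?tE //.
  by symmetry; apply: convE => l lk; rewrite tE // (lepm_trans lk).
by symmetry; apply: convE => l lk; rewrite tE // (lepm_trans lk).
Qed.

Lemma convDl a b f m : conv (fun u => a u + b u) f m = conv a f m + conv b f m.
Proof. by rewrite -big_split; apply: eq_bigr => u _; rewrite mulrDl. Qed.

Lemma conv_suml (J : finType) (c : J -> K) (a : J -> 'X_{1..n} -> K) f m :
  conv (fun u => \sum_j c j * a j u) f m = \sum_j c j * conv (a j) f m.
Proof.
under [RHS]eq_bigr do rewrite mulr_sumr.
rewrite exchange_big; apply: eq_bigr => u _; rewrite mulr_suml.
by apply: eq_bigr => j _; rewrite mulrA.
Qed.

Lemma conv_shiftl r a f m : conv (shift r a) f m = shift r (conv a f) m.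
Proof.
set t := trunc (mdeg m).+1.
have tE c k : (k <= m)%MM -> (t c)@_k = c k by exact: mcoeff_trunc.
rewrite (@convE ('X_[r] * t a) (t f)) => [|k km|k /tE //]; last first.
  rewrite mcoeffXM /shift; case: ifP => // rk.
  by rewrite /mcoeffs tE // (lepm_trans _ km) ?lem_subr.
rewrite -mulrA mcoeffXM /shift; case: ifP => // rm.
by symmetry; apply: convE => k km; rewrite tE // (lepm_trans km) ?lem_subr.
Qed.

Lemma conv_shiftr r a f m : conv a (shift r f) m = shift r (conv a f) m.
Proof.
rewrite convC conv_shiftl /shift; case: ifP => // _; exact: convC.
Qed.

Lemma euler_conv i a f m :
  euler i (conv a f) m = conv (euler i a) f m + conv a (euler i f) m.
Proof.
set t := trunc (mdeg m).+1.
have tE c k : (k <= m)%MM -> (t c)@_k = c k by exact: mcoeff_trunc.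
have eE c k : (k <= m)%MM -> ('X_i * (t c)^`M(i))@_k = euler i c k.
  by move=> km; rewrite mcoeff_euler /euler /mcoeffs tE.
rewrite (convE (eE a) (tE f)) (convE (tE a) (eE f)) -mcoeffD.
have -> : 'X_i * (t a)^`M(i) * t f + t a * ('X_i * (t f)^`M(i)) = 'X_i * (t a * t f)^`M(i).
  by rewrite mderivM; ring.
by rewrite mcoeff_euler /euler conv_trunc.
Qed.

Lemma conv0 a f : conv a f 0%MM = a 0%MM * f 0%MM.
Proof.
have tE c : (trunc 1 c)@_0 = c 0%MM by rewrite mcoeff_mpoly // mdeg0.
by rewrite conv_trunc mdeg0 rmorphM /= !tE.
Qed.

Lemma mderiv_exp i g k : (g ^+ k.+1)^`M(i) = k.+1%:R *: (g^`M(i) * g ^+ k).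
Proof.
elim: k => [|k IH]; first by rewrite expr1 expr0 mulr1 scale1r.
rewrite exprS mderivM IH -scalerAr mulrCA -exprS -[k.+2%:R]natr1 addrC scalerDl.
by rewrite scale1r mulrC.
Qed.

(** One polynomial for all coefficients of exp g of degree below d, when g has no constant term;
    [mexp] truncates differently at each monomial and cannot be differentiated directly. *)
Definition expoly d g : {mpoly K[n]} := \sum_(k < d) (k`!)%:R^-1 *: g ^+ k.

Lemma mcoeff_exp_lt g k m : g@_0%MM = 0 -> (mdeg m < k)%N -> (g ^+ k)@_m = 0.
Proof.
move=> g0; elim: k m => // k IH m mk; rewrite exprS -conv_mcoeffs.
apply: big1 => u um; rewrite /mcoeffs; have [->|u0] := eqVneq (u : 'X_{1..n}) 0%MM.
  by rewrite g0 mul0r.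
rewrite IH ?mulr0 //; have := mdeg_subm um.
by move: u0 mk; rewrite -mdeg_eq0 -lt0n; lia.
Qed.

Lemma mexpE d g m : g@_0%MM = 0 -> (mdeg m < d)%N -> mexp g m = (expoly d g)@_m.
Proof.
move=> g0 md; rewrite raddf_sum /= /mexp (big_ord_widen d (fun k => (g ^+ k)@_m / k`!%:R) md).
rewrite big_mkcond; apply: eq_bigr => k _; rewrite mcoeffZ mulrC.
by case: ifPn => //; rewrite -leqNgt => mk; rewrite mcoeff_exp_lt // mulr0.
Qed.

Lemma mexp0E g : g@_0%MM = 0 -> mexp g 0%MM = 1.
Proof. by move=> g0; rewrite (@mexpE 1) ?mdeg0 // /expoly big_ord1 expr0 fact0 invr1 scale1r mcoeff1 eqxx. Qed.

Lemma mexp_0 m : mexp (0 : {mpoly K[n]}) m = (m == 0%MM)%:R.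
Proof.
rewrite (@mexpE (mdeg m).+1) ?mcoeff0 // /expoly big_ord_recl big1 => [|k _].
  by rewrite expr0 fact0 invr1 scale1r addr0 mcoeff1.
by rewrite expr0n scaler0.
Qed.

(** The powers of g stay supported in any submonoid containing the support of g. Applied to the cone
    of nonnegative weights, this locates the support of [Z]. *)
Lemma mexp_supp (S : 'X_{1..n} -> Prop) g m :
  S 0%MM -> (forall u v, S u -> S v -> S (u + v)%MM) ->
  (forall u, u \in msupp g -> S u) -> mexp g m != 0 -> S m.
Proof.
move=> S0 SD Sg.
have Sexp k u : u \in msupp (g ^+ k) -> S u.
  elim: k u => [|k IH] u; first by rewrite expr0 msupp1 inE => /eqP ->.
  rewrite exprS => /msuppM_le /allpairsP[[v w] /= [/Sg Sv /IH Sw ->]]; exact: SD.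
move=> eN0; have [k] : exists k : 'I_(mdeg m).+1, (g ^+ k)@_m != 0.
  apply/existsP; apply: contraNT eN0; rewrite negb_exists => /forallP H.
  by rewrite /mexp big1 // => k _; rewrite (eqP (negbNE (H k))) mul0r.
by rewrite -mcoeff_msupp => /Sexp.
Qed.

Hypothesis K0 : [pchar K] =i pred0.

Let natr_neq0 k : (0 < k)%N -> k%:R != 0 :> K.
Proof. by move=> k0; rewrite ((pcharf0P K).1 K0) -lt0n. Qed.

Lemma mderiv_expoly i d g : (expoly d.+1 g)^`M(i) = g^`M(i) * expoly d g.
Proof.
rewrite raddf_sum /= big_ord_recl /= expr0 linearZ /= -mpolyC1 mderivC scaler0 add0r.
rewrite mulr_sumr; apply: eq_bigr => k _; rewrite linearZ /= mderiv_exp scalerA -scalerAr.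
congr (_ *: _); rewrite factS natrM invfM mulrAC mulVf ?mul1r //.
exact: natr_neq0.
Qed.

Lemma euler_mexp i g m : g@_0%MM = 0 ->
  euler i (mexp g) m = conv (mcoeffs ('X_i * g^`M(i))) (mexp g) m.
Proof.
move=> g0; set d := (mdeg m).+1.
(* One term more than the degree of m requires, because differentiation turns [expoly d.+1 g] into a
   multiple of [expoly d g]. *)
rewrite /euler (@mexpE d.+1 g) //.
have := mcoeff_euler i (expoly d.+1 g) m; rewrite /euler /mcoeffs => <-.
rewrite mderiv_expoly mulrA; symmetry; apply: convE => // k km.
by rewrite -mexpE // ltnS mdeg_lepm.
Qed.

(* A system of Euler equations whose right-hand sides have no constant term
   determines the coefficients recursively from the constant one. *)
Lemma euler_unique N (L : 'I_n -> 'X_{1..n} -> K) a b :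
  (forall i, L i 0%MM = 0) -> a 0%MM = b 0%MM ->
  (forall i m, (mdeg m <= N)%N -> euler i a m = conv (L i) a m) ->
  (forall i m, (mdeg m <= N)%N -> euler i b m = conv (L i) b m) ->
  forall m, (mdeg m <= N)%N -> a m = b m.
Proof.
move=> L0 ab0 aE bE m; have [k] := ubnP (mdeg m); elim: k m => // k IH m mk mN.
have [->//|m0] := eqVneq m 0%MM.
have [i mi] : exists i, m i != 0%N.
  apply/existsP; apply: contraNT m0; rewrite negb_exists => /forallP H.
  by apply/eqP/mnmP => i; rewrite mnm0E; apply/eqP/negbNE/H.
have : euler i a m = euler i b m.
  rewrite aE // bE //; apply: eq_bigr => u um.
  have [->|u0] := eqVneq (u : 'X_{1..n}) 0%MM; first by rewrite L0 !mul0r.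
  have := mdeg_subm um; move: u0; rewrite -mdeg_eq0 -lt0n => u0 uE.
  by rewrite IH //; lia.
by apply: mulfI; rewrite natr_neq0 // lt0n.
Qed.

Lemma mcoeff_euler0 i P : ('X_i * P^`M(i))@_0%MM = 0.
Proof. by rewrite mcoeff_euler /euler mnm0E mul0r. Qed.

(** Both sides have constant coefficient 1 and solve the Euler system attached to g + h, so
    [euler_unique] identifies them without rearranging double sums of powers. *)
Lemma mexpD g h m : g@_0%MM = 0 -> h@_0%MM = 0 ->
  mexp (g + h) m = conv (mexp g) (mexp h) m.
Proof.
move=> g0 h0; have gh0 : (g + h)@_0%MM = 0 by rewrite mcoeffD g0 h0 addr0.
apply: (@euler_unique (mdeg m) (fun i => mcoeffs ('X_i * (g + h)^`M(i)))) => //.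
- by move=> i; exact: mcoeff_euler0.
- by rewrite conv0 !mexp0E // mulr1.
- by move=> i k _; rewrite euler_mexp.
move=> i k _; rewrite euler_conv.
have -> : conv (mcoeffs ('X_i * (g + h)^`M(i))) (conv (mexp g) (mexp h)) k =
    conv (fun u => mcoeffs ('X_i * g^`M(i)) u + mcoeffs ('X_i * h^`M(i)) u) (conv (mexp g) (mexp h)) k.
  by apply: eq_conv_le => // u _; rewrite /mcoeffs -mcoeffD -mulrDr mderivD.
rewrite convDl; congr (_ + _).
  by rewrite convA; apply: eq_conv_le => // u _; rewrite euler_mexp.
rewrite [RHS]convA [RHS](@eq_conv_le _ (conv (mexp g) (mcoeffs ('X_i * h^`M(i)))) _ (mexp h)) //.
  by rewrite -convA; apply: eq_conv_le => // u _; rewrite euler_mexp.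
by move=> u _; exact: convC.
Qed.

(* exp (log (1 - x)) = 1 - x for x = pi X^r, modulo terms of degree > N *)
Lemma mexp_log N (pi : K) r m : r != 0%MM -> (mdeg m <= N)%N ->
  mexp (- \sum_(k < N) (pi ^+ k.+1 / k.+1%:R) *: 'X_[r] ^+ k.+1) m
  = (1 - pi *: 'X_[r])@_m.
Proof.
move=> r0; set g := - _ => mN.
have Xk0 k : ('X_[r] ^+ k.+1 : {mpoly K[n]})@_0%MM = 0.
  by rewrite mcoeffXn; case: eqP => // /(congr1 (@mdeg n)); rewrite mdegMn mdeg0 => /eqP; rewrite muln_eq0 mdeg_eq0 (negPf r0).
have g0 : g@_0%MM = 0.
  rewrite mcoeffN raddf_sum /= big1 ?oppr0 // => k _.
  by rewrite mcoeffZ Xk0 mulr0.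
apply: (@euler_unique N (fun i => mcoeffs ('X_i * g^`M(i))) (mexp g) (mcoeffs (1 - pi *: 'X_[r]))) => //.
- by move=> i; exact: mcoeff_euler0.
- rewrite mexp0E // /mcoeffs mcoeffB mcoeff1 eqxx mcoeffZ -['X_[r]]expr1.
  by rewrite Xk0 mulr0 subr0.
- by move=> i k _; exact: euler_mexp.
move=> i k kN; rewrite conv_mcoeffs -mcoeff_euler.
set w : {mpoly K[n]} := pi *: 'X_[r].
pose e : K := (r i)%:R.
have XX : 'X_i * 'X_[r]^`M(i) = e *: 'X_[r] :> {mpoly K[n]}.
  apply/mpolyP => u; rewrite mcoeff_euler mcoeffZ /euler /mcoeffs mcoeffX.
  by case: eqP => [<-|] //; rewrite !mulr0.
have wE : 'X_i * w^`M(i) = e *: w by rewrite mderivZ -scalerAr XX scalerA mulrC -scalerA.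
have gE : 'X_i * g^`M(i) = - (e *: (w * \sum_(j < N) w ^+ j)).
  rewrite mderivN mulrN; congr (- _); rewrite raddf_sum /= mulr_sumr mulr_sumr scaler_sumr.
  apply: eq_bigr => j _; rewrite -exprS mderivZ mderiv_exp scalerA mulrVK ?unitfE ?natr_neq0 //.
  by rewrite -scalerAr mulrA XX -scalerAl -exprS scalerA mulrC -scalerA exprZn.
rewrite gE mderivB -mpolyC1 mderivC sub0r mulrN mpolyC1 wE.
(* The truncated logarithm differentiates to a finite geometric series, which telescopes against 1 -
   w. The error is a multiple of w^(N+1), of degree above N because r is nonzero. *)
have -> : - (e *: (w * \sum_(j < N) w ^+ j)) * (1 - w) = - (e *: w) + e *: w ^+ N.+1.
  have SE : (\sum_(j < N) w ^+ j) * (1 - w) = 1 - w ^+ N.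
    by rewrite mulrC -opprB mulNr -subrX1 opprB.
  by rewrite mulNr -scalerAl -mulrA SE mulrBr mulr1 scalerBr opprB addrC exprS.
rewrite mcoeffD [X in _ = _ + X]mcoeffZ exprZn mcoeffZ mcoeffXn.
suff -> : ((r *+ N.+1)%MM == k) = false by rewrite !mulr0 addr0.
apply/eqP => rk; move: kN; rewrite -rk mdegMn leqNgt; case/negP.
by rewrite leq_pmull // lt0n mdeg_eq0.
Qed.

End FormalExponential.

(** * Overconvergence of the Dwork exponential *)

Section DworkExponential.
Variables (p : nat) (R : realType) (K : closedFieldType) (ord : K -> \bar R).
Hypotheses (p_prime : prime p) (Cp : is_Cp p ord).
Variables (n : nat) (pi : K).
Hypothesis pi_root : pi ^+ p.-1 = - p%:R.
Implicit Types (a b : 'X_{1..n} -> K) (m r s : 'X_{1..n}) (g : {mpoly K[n]}) (e : R).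

(** No additive constant is allowed, so that products of series of slope e keep slope e however many
    factors there are. *)
Definition slope e a := forall m, vge ord (e * (mdeg m)%:R) (a m).

Let K0 : [pchar K] =i pred0 := Cp_pchar0 Cp p_prime.

Lemma slope_le e e' a : e' <= e -> slope e a -> slope e' a.
Proof. by move=> ee' ea m; apply: vgeW (ea m); apply: ler_wpM2r. Qed.

(** The bounds are asked for below m only: in [slope_dwork] one factor is known only up to a finite
    degree. *)
Lemma vge_conv e a b m :
  (forall u, (u <= m)%MM -> vge ord (e * (mdeg u)%:R) (a u)) ->
  (forall u, (u <= m)%MM -> vge ord (e * (mdeg u)%:R) (b u)) ->
  vge ord (e * (mdeg m)%:R) (conv a b m).
Proof.
move=> ea eb; apply: (vge_sum Cp) => u um.
have <- : e * (mdeg u)%:R + e * (mdeg (m - u))%:R = e * (mdeg m)%:R.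
  by rewrite -mulrDr -natrD mdeg_subm.
by apply: (vgeM Cp); [exact: ea | exact/eb/lem_subr].
Qed.

(** The term c^k x^(k s) / k! has valuation at least k v - k / (p - 1) by [vge_invfact], and degree
    k |s|. *)
Lemma slope_mexp_monomial e v c s : vge ord v c ->
  e * (mdeg s)%:R <= v - p.-1%:R^-1 -> slope e (mexp (c *: 'X_[s])).
Proof.
move=> vc esv m; apply: (vge_sum Cp) => -[k /= _] _.
rewrite exprZn mcoeffZ mcoeffXn; case: eqP => [<-|_]; last first.
  by rewrite mulr0 mul0r; exact: (vge0 Cp).
rewrite mulr1; apply: vgeW (vgeM Cp (vgeX Cp k vc) (vge_invfact Cp k p_prime)).
rewrite mdegMn natrM mulrA -[v *+ k]mulr_natr [k%:R / _]mulrC -mulrBl.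
exact: ler_wpM2r.
Qed.

Lemma slope_mexp_sum e (J : Type) (t : seq J) (P : pred J) (G : J -> {mpoly K[n]}) :
  (forall j, P j -> (G j)@_0%MM = 0) -> (forall j, P j -> slope e (mexp (G j))) ->
  slope e (mexp (\sum_(j <- t | P j) G j)).
Proof.
move=> G0 eG; suff [] : (\sum_(j <- t | P j) G j)@_0%MM = 0 /\
  slope e (mexp (\sum_(j <- t | P j) G j)) by [].
elim/big_rec: _ => [|j g Pj [g0 eg]].
  split=> [|m]; first by rewrite mcoeff0.
  rewrite mexp_0; case: eqP => [->|_]; last exact: (vge0 Cp).
  by apply: vge_ord (ord1 Cp) _; rewrite mdeg0 mulr0.
split=> [|m]; first by rewrite mcoeffD G0 // g0 addr0.
by rewrite mexpD ?G0 //; apply: vge_conv => u _; [exact: eG | exact: eg].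
Qed.

(** Divided by p^2 (p - 1), this reads k / (p - 1) - v_p(k) - 1 / (p - 1) >= k / p^2: the left side
    is the valuation of pi^k / k less the loss from the factorials. It fails at k = 1 and k = p, the
    two terms left out of [rest] in [slope_dwork], and is an equality at p = 2, k = 4. *)
Lemma logn_slope k : (1 < k)%N -> k != p ->
  (logn p k * (p ^ 2 * p.-1) + k * p.-1 + p ^ 2 <= p ^ 2 * k)%N.
Proof.
move=> k1 kp; have k0 : (0 < k)%N by exact: ltnW.
have [q pE] : exists q, p = q.+2 by case: p p_prime => [|[|q]] //; exists q.
have [a cpa kE] := pfactor_coprime p_prime k0.
move: (logn p k) kE => v kE.
(* Multiplying j by p while raising l by one preserves the inequality, so only two starting points
   are checked: p^2 when k is a power of p, and otherwise the prime-to-p part of k. *)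
have step l j : (l * (p ^ 2 * p.-1) + j * p.-1 + p ^ 2 <= p ^ 2 * j)%N ->
    (l.+1 * (p ^ 2 * p.-1) + (j * p) * p.-1 + p ^ 2 <= p ^ 2 * (j * p))%N.
  by rewrite pE /= -[q.+2]addn1; move: (q.+1) => {pE kE v} Q; nia.
have steps l j t : (l * (p ^ 2 * p.-1) + j * p.-1 + p ^ 2 <= p ^ 2 * j)%N ->
    ((l + t) * (p ^ 2 * p.-1) + (j * p ^ t) * p.-1 + p ^ 2 <= p ^ 2 * (j * p ^ t))%N.
  elim: t => [|t IH] H; first by rewrite addn0 expn0 muln1.
  by rewrite addnS [(p ^ t.+1)%N]expnSr [(j * (_ * p))%N]mulnA; apply/step/IH.
have [a1|a1] := leqP a 1.
  have {a1} a1 : a = 1%N.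
    by apply/eqP; rewrite eqn_leq a1 lt0n; apply: contraTneq k0 => a0; rewrite kE a0.
  case: v kE => [|[|v]] kE; rewrite a1 mul1n in kE.
  - by rewrite kE in k1.
  - by rewrite kE expn1 eqxx in kp.
  rewrite kE -[v.+2]add2n expnD; apply: steps.
  by rewrite pE /=; nia.
rewrite kE -[v]add0n; apply: steps; rewrite pE /=; nia.
Qed.

Lemma slope_dwork r : r != 0%MM ->
  slope (p ^ 2 * mdeg r)%:R^-1 (mexp (pi *: ('X_[r] ^+ p - 'X_[r]))).
Proof.
(* N is at least the degree of m, so that [mexp_log] applies, and at least p, so that the truncated
   logarithm contains its p-th term. *)
move=> r0 m; set e := _%:R^-1; pose N := maxn (mdeg m) p.
have mN : (mdeg m <= N)%N by exact: leq_maxl.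
have pN : (p <= N)%N by exact: leq_maxr.
have p1 := prime_gt1 p_prime.
have pp1 : (0 < p.-1)%N by case: p p1 => [|[]].
have r1 : (0 < mdeg r)%N by rewrite lt0n mdeg_eq0.
have q0 : 0 < p.-1%:R :> R by rewrite ltr0n.
have e0 k : e * (mdeg r * k)%:R = k%:R / (p ^ 2)%:R.
  have r1R : (mdeg r)%:R != 0 :> R by rewrite pnatr_eq0 -lt0n.
  by rewrite /e !natrM invfM -mulrA mulKf // mulrC.
pose u : {mpoly K[n]} := 'X_[r].
pose c k : K := pi ^+ k.+1 / k.+1%:R.
have uk0 k : (u ^+ k.+1)@_0%MM = 0.
  rewrite mcoeffXn; case: eqP => // /(congr1 (@mdeg n)).
  by rewrite mdegMn mdeg0 => /eqP; rewrite muln_eq0 mdeg_eq0 (negPf r0).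
pose L := - \sum_(k < N) c k *: u ^+ k.+1.
pose rest := \sum_(k < N | (k != 0 :> nat) && (k != p.-1 :> nat)) c k *: u ^+ k.+1.
have -> : pi *: (u ^+ p - u) = L + rest.
  pose i0 := Ordinal (leq_trans (prime_gt0 p_prime) pN).
  have pN' : (p.-1 < N)%N by rewrite prednK ?prime_gt0.
  pose ip := Ordinal pN'.
  rewrite /L (bigD1 i0) //= (bigD1 ip) /=; last by rewrite -val_eqE /= -lt0n.
  have -> : \sum_(i < N | (i != i0) && (i != ip)) c i *: u ^+ i.+1 = rest by apply: eq_bigl.
  rewrite /c expr1 divr1 prednK ?prime_gt0 //.
  have -> : pi ^+ p / p%:R = - pi.
    rewrite -{1}(prednK (prime_gt0 p_prime)) exprSr pi_root !mulNr mulrAC mulfV ?mul1r //.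
    by rewrite (Cp_natr_eq0 Cp _ p_prime) -lt0n prime_gt0.
  by rewrite expr1 scaleNr scalerBr; ring.
have L0 : L@_0%MM = 0.
  by rewrite mcoeffN raddf_sum /= big1 ?oppr0 // => k _; rewrite mcoeffZ uk0 mulr0.
have rest0 : rest@_0%MM = 0.
  by rewrite raddf_sum /= big1 // => k _; rewrite mcoeffZ uk0 mulr0.
have vpi : vge ord p.-1%:R^-1 pi by apply: vge_ord (ord_root Cp p_prime pi_root) _.
rewrite mexpD //; apply: vge_conv => s sm.
  rewrite (@mexp_log _ _ K0 N pi r s r0) ?(leq_trans (mdeg_lepm sm)) //.
  rewrite mcoeffB mcoeff1 mcoeffZ mcoeffX.
  have [->|s0] := eqVneq s 0%MM.
    by rewrite (negPf r0) mulr0 subr0 mdeg0 mulr0; apply: vge_ord (ord1 Cp) _.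
  rewrite sub0r; apply: (vgeN Cp); case: eqP => [<-|_]; last by rewrite mulr0; exact: (vge0 Cp).
  rewrite mulr1; apply: vgeW vpi.
  have := e0 1%N; rewrite muln1 => ->; rewrite mul1r lef_pV2 ?posrE ?ltr0n ?expn_gt0 ?(ltnW p1) //.
  by rewrite ler_nat; case: p p1 => // q _ /=; nia.
suff rS : slope e (mexp rest) by exact: rS.
apply: slope_mexp_sum => k /andP[k0 kp]; first by rewrite mcoeffZ uk0 mulr0.
rewrite mpolyXn; apply: (@slope_mexp_monomial _ (k.+1%:R / p.-1%:R - (logn p k.+1)%:R)).
  apply: (vgeM Cp).
    apply: vge_ord (ordX Cp _ (ord_root Cp p_prime pi_root)) _.
    by rewrite -[X in _ <= X]mulr_natl.
  apply: vge_ord (ordV Cp _ (ord_nat Cp p_prime _)) _ => //.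
  by rewrite (Cp_natr_eq0 Cp _ p_prime).
rewrite mdegMn e0.
have kp' : k.+1 != p by apply: contra kp => /eqP <-.
have k1 : (1 < k.+1)%N by rewrite ltnS lt0n.
have P0 : 0 < (p ^ 2)%:R :> R by rewrite ltr0n expn_gt0 prime_gt0.
have := logn_slope k1 kp'; rewrite -(ler_nat R) !natrD 2!natrM [in X in _ -> X]/=.
rewrite ler_pdivrMr // => H.
rewrite -(ler_pM2r q0); apply: le_trans (_ : (p ^ 2 * k.+1)%:R - (logn p k.+1)%:R * (p ^ 2 * p.-1)%:R - (p ^ 2)%:R <= _).
  by move: H; rewrite !natrM; lra.
rewrite !natrM le_eqVlt; apply/orP; left; apply/eqP; field.
by rewrite gt_eqF.
Qed.

Lemma mrowM (A : 'M[nat]_n) i : mrow (A *+ p) i = (mrow A i *+ p)%MM.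
Proof.
apply/mnmP => j; rewrite mulmnE !mnmE.
by elim: p => [|k IH]; rewrite ?muln0 ?mulr0n ?mxE // mulrS mxE IH mulnS.
Qed.

Lemma Z_mexp (A : 'M[nat]_n) :
  pi *: (W K (A *+ p) - W K A) = \sum_i pi *: ('X_[mrow A i] ^+ p - 'X_[mrow A i]).
Proof.
rewrite /W -sumrB scaler_sumr; apply: eq_bigr => i _.
by rewrite mrowM mpolyXn.
Qed.

Lemma Z_const (A : 'M[nat]_n) : (forall i, mrow A i != 0%MM) ->
  (pi *: (W K (A *+ p) - W K A))@_0%MM = 0.
Proof.
move=> A0; rewrite Z_mexp raddf_sum /= big1 // => i _.
rewrite mcoeffZ mcoeffB mcoeffXn mcoeffX (negPf (A0 i)).
rewrite -mdeg_eq0 mdegMn muln_eq0 mdeg_eq0 (negPf (A0 i)) /=.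
by rewrite gtn_eqF ?prime_gt0 // subrr mulr0.
Qed.

Lemma slope_Z (A : 'M[nat]_n) : (forall i, mrow A i != 0%MM) ->
  exists2 e : R, 0 < e & slope e (Z p pi A).
Proof.
(* The slope in [slope_dwork] decreases with the degree of the row, so a common bound on these
   degrees gives a common slope; the successor keeps it positive when n = 0. *)
move=> A0; pose D := (\sum_i mdeg (mrow A i)).+1.
have P0 : (0 < p ^ 2)%N by rewrite expn_gt0 prime_gt0.
exists (p ^ 2 * D)%:R^-1; first by rewrite invr_gt0 ltr0n muln_gt0 P0.
rewrite /slope /Z Z_mexp; apply: slope_mexp_sum => i _.
  rewrite mcoeffZ mcoeffB mcoeffXn mcoeffX (negPf (A0 i)).
  rewrite -mdeg_eq0 mdegMn muln_eq0 mdeg_eq0 (negPf (A0 i)) /=.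
  by rewrite gtn_eqF ?prime_gt0 // subrr mulr0.
apply: slope_le (slope_dwork (A0 i)).
have r0 : (0 < mdeg (mrow A i))%N by rewrite lt0n mdeg_eq0.
have d0 j : (0 < j)%N -> (p ^ 2 * j)%:R \is @Num.pos R by rewrite posrE ltr0n muln_gt0 P0.
rewrite lef_pV2; [|exact: d0|exact: d0].
by rewrite ler_nat leq_pmul2l // /D (bigD1 i) //= -addnS leq_addr.
Qed.

End DworkExponential.

(** * Operators with integer eigenvalues *)

Section LinearMaps.
Variables (K : fieldType) (U V : lmodType K) (f : U -> V).
Hypothesis fL : linear f.

Lemma linear_0 : f 0 = 0.
Proof. by have := fL (-1) 0 0; rewrite scaleN1r oppr0 addr0 scaleN1r addNr. Qed.

Lemma linear_scale c u : f (c *: u) = c *: f u.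
Proof. by rewrite -[c *: u]addr0 fL linear_0 addr0. Qed.

Lemma linear_add u v : f (u + v) = f u + f v.
Proof. by rewrite -{1}[u]scale1r fL scale1r. Qed.

Lemma linear_opp u : f (- u) = - f u.
Proof. by rewrite -scaleN1r linear_scale scaleN1r. Qed.

Lemma linear_sub u v : f (u - v) = f u - f v.
Proof. by rewrite linear_add linear_opp. Qed.

Lemma linear_bigsum (I : Type) (s : seq I) (P : pred I) F :
  f (\sum_(i <- s | P i) F i) = \sum_(i <- s | P i) f (F i).
Proof. by elim/big_rec2: _ => [|i y x _ <-]; [exact: linear_0 | exact: linear_add]. Qed.

End LinearMaps.

Section PowerOfOperatorTheory.
Variables (p N : nat) (K : fieldType).

Lemma linear_comb_sum (U V : lmodType K) (I : Type) (s : seq I) (P : pred I) (F : I -> U -> V) :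
  (forall i, linear (F i)) -> linear (fun u => \sum_(i <- s | P i) F i u).
Proof.
move=> FL c u v; rewrite scaler_sumr -big_split; apply: eq_bigr => i _; exact: FL.
Qed.

Lemma linear_scaled (U V : lmodType K) a (f : U -> V) :
  linear f -> linear (fun u => a *: f u).
Proof. by move=> fL c u v; rewrite fL scalerDr !scalerA mulrC. Qed.

Lemma linear_addf (U V : lmodType K) (f g : U -> V) :
  linear f -> linear g -> linear (fun u => f u + g u).
Proof. by move=> fL gL c u v; rewrite fL gL scalerDr addrACA. Qed.

Lemma linear_comp (U V X : lmodType K) (f : V -> X) (g : U -> V) :
  linear f -> linear g -> linear (fun u => f (g u)).
Proof. by move=> fL gL c u v; rewrite gL fL. Qed.

(** [ppow] is a polynomial in its operator, with coefficients depending only on p and N, so it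
    follows any linear intertwining map. *)
Lemma ppow_morph (U V : lmodType K) (f : U -> V) (Q : U -> U) (Q' : V -> V) u :
  linear f -> (forall v, f (Q v) = Q' (f v)) ->
  f (ppow p N Q u) = ppow p N Q' (f u).
Proof.
move=> fL fQ; rewrite (linear_bigsum fL); apply: eq_bigr => x _.
rewrite (linear_scale fL); congr (_ *: _); rewrite /eigenproj.
elim: (int_range N) => //= y s IH; case: ifP => // _.
by rewrite (linear_scale fL) (linear_sub fL) fQ (linear_scale fL) IH.
Qed.

End PowerOfOperatorTheory.

Section RatrChar0.
Variable K : fieldType.
Hypothesis K0 : [pchar K] =i pred0.

Let intr_neq0 (a : int) : a != 0 -> a%:~R != 0 :> K.
Proof.
case: a => k k0; first by rewrite -pmulrn ((pcharf0P K).1 K0).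
by rewrite NegzE mulrNz oppr_eq0 -pmulrn ((pcharf0P K).1 K0).
Qed.

Lemma ratr_frac (a b : int) : b != 0 -> ratr (a%:Q / b%:Q) = a%:~R / b%:~R :> K.
Proof.
move=> b0; rewrite /ratr; set x := _ / _ : rat.
have d0 : denq x != 0 by exact: denq_neq0.
have E : numq x * b = a * denq x.
  apply/eqP; rewrite -(eqr_int rat) !intrM; apply/eqP.
  have <- : x * b%:Q = a%:Q by rewrite /x divfK // intr_eq0.
  have <- : x * (denq x)%:Q = (numq x)%:Q by rewrite -{1}(divq_num_den x) divfK // intr_eq0.
  by rewrite mulrAC.
apply/eqP; rewrite eqr_div ?intr_neq0 //; apply/eqP.
by rewrite -!intrM E.
Qed.

Lemma ratr_nat0 k : ratr k%:R = k%:R :> K.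
Proof. by have := @ratr_frac k 1 isT; rewrite !divr1. Qed.

Lemma ratr_add (x y : rat) : ratr (x + y) = ratr x + ratr y :> K.
Proof.
have dx : denq x != 0 by exact: denq_neq0.
have dy : denq y != 0 by exact: denq_neq0.
have -> : x + y = (numq x * denq y + numq y * denq x)%:Q / (denq x * denq y)%:Q.
  rewrite -{1}(divq_num_den x) -{1}(divq_num_den y) intrD !intrM.
  by field; rewrite !intr_eq0 dx dy.
rewrite ratr_frac ?mulf_neq0 // intrD !intrM /ratr.
by field; rewrite !intr_neq0.
Qed.

Lemma ratr_mul (x y : rat) : ratr (x * y) = ratr x * ratr y :> K.
Proof.
have dx : denq x != 0 by exact: denq_neq0.
have dy : denq y != 0 by exact: denq_neq0.
have -> : x * y = (numq x * numq y)%:Q / (denq x * denq y)%:Q.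
  rewrite -{1}(divq_num_den x) -{1}(divq_num_den y) !intrM.
  by field; rewrite !intr_eq0 dx dy.
rewrite ratr_frac ?mulf_neq0 // !intrM /ratr.
by field; rewrite !intr_neq0.
Qed.

Lemma ratr_sum0 (I : Type) (s : seq I) (P : pred I) (F : I -> rat) :
  ratr (\sum_(i <- s | P i) F i) = \sum_(i <- s | P i) ratr (F i) :> K.
Proof.
elim/big_rec2: _ => [|i y x _ <-]; last exact: ratr_add.
by have := ratr_nat0 0.
Qed.

End RatrChar0.

Section AnticommutingFamily.
Variables (n : nat) (K : fieldType) (U : lmodType K) (a : 'I_n -> U -> U).
Hypothesis aL : forall i, linear (a i).
Hypothesis aC : forall i j u, a i (a j u) = - a j (a i u).
Hypothesis K2 : 2 != 0 :> K.

Lemma anticomm_sq i u : a i (a i u) = 0.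
Proof.
have /eqP := aC i i u.
by rewrite -addr_eq0 -mulr2n -scaler_nat scaler_eq0 (negPf K2) => /eqP.
Qed.

Lemma anticomm_foldr_mem i s u : i \in s -> a i (foldr a u s) = 0.
Proof.
elim: s => //= j s IH; rewrite inE; case: eqVneq => [<-|_] /=; first by rewrite anticomm_sq.
by move/IH => ai0; rewrite aC ai0 (linear_0 (aL j)) oppr0.
Qed.

Lemma foldr_linear s : linear (fun u => foldr a u s).
Proof. by elim: s => //= i s IH; exact: linear_comp. Qed.

(** The factor [a i] moves to the front past the smaller factors, one sign each. A general sorted
    list replaces the enumeration of the indices so that induction can remove its head. *)
Lemma anticomm_foldr_setU1 i (J : {set 'I_n}) s u :
  sorted ltn (map val s) -> i \in s -> i \notin J ->
  foldr a u [seq j <- s | j \in i |: J] =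
  (-1) ^+ count (fun j : 'I_n => (j \in J) && (j < i)%N) s *:
    a i (foldr a u [seq j <- s | j \in J]).
Proof.
elim: s => //= j s IH; rewrite (path_sortedE ltn_trans) => /andP[/allP js /IH{}IH].
rewrite inE; case: eqVneq => [ij _|ij] /=.
  move=> iJ; have js' k : k \in s -> (j < k)%N by move=> ks; apply: js; apply: map_f.
  rewrite -ij setU11 (negPf iJ) /=; rewrite -ij in js'.
  rewrite (_ : count _ s = 0%N) ?scale1r.
    congr (a i (foldr a u _)); apply: eq_in_filter => k ks; rewrite in_setU1.
    by case: eqVneq => // kE; have := js' k ks; rewrite kE ltnn.
  by apply/eqP; rewrite -leqn0 leqNgt -has_count; apply/hasPn => k /js' ik; rewrite ltnNge (ltnW ik) andbF.
move=> is_ iJ; have ji : (j < i)%N by apply: js; apply: map_f.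
rewrite in_setU1 eq_sym (negPf ij) /= ji andbT; case: ifP => jJ /=; last by rewrite add0n IH.
by rewrite IH // (linear_scale (aL j)) aC exprD expr1 mulN1r scaleNr scalerN.
Qed.

End AnticommutingFamily.

(** * Exterior algebra *)

Section ExteriorTheory.
Variables (n : nat) (K : fieldType) (V : lmodType K) (pi : K).
Hypothesis K0 : [pchar K] =i pred0.
Hypothesis pi0 : pi != 0.
Implicit Types (i j k : 'I_n) (w : extp n V) (A : 'M[nat]_n) (I J : {set 'I_n}).

Let K2 : 2 != 0 :> K.
Proof. by rewrite ((pcharf0P K).1 K0). Qed.

Lemma extpD w w' I : (w + w') I = w I + w' I. Proof. by rewrite ffunE. Qed.
Lemma extpN w I : (- w) I = - w I. Proof. by rewrite ffunE. Qed.
Lemma extpZ c w I : (c *: w) I = c *: w I. Proof. by rewrite ffunE. Qed.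
Lemma extp0 I : (0 : extp n V) I = 0. Proof. by rewrite ffunE. Qed.
Lemma extp_sum (T : Type) (s : seq T) (P : pred T) (F : T -> extp n V) I :
  (\sum_(t <- s | P t) F t) I = \sum_(t <- s | P t) F t I.
Proof. by elim/big_rec2: _ => [|t y x _ <-]; rewrite ffunE. Qed.

Lemma wedge_linear i : linear (@wedge n K V i).
Proof.
move=> c u v; apply/ffunP => I; rewrite extpD extpZ !ffunE; case: ifP => _.
  by rewrite scalerDr !scalerA mulrC.
by rewrite scaler0 addr0.
Qed.

Lemma contract_linear i : linear (@contract n K V i).
Proof.
move=> c u v; apply/ffunP => I; rewrite extpD extpZ !ffunE; case: ifP => _.
  by rewrite scaler0 addr0.
by rewrite scalerDr !scalerA mulrC.
Qed.

Lemma sign_ltn_neq i j : i != j ->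
  (-1) ^+ (i < j)%N = - (-1) ^+ (j < i)%N :> K.
Proof. by rewrite -val_eqE; case: ltngtP => //= _ _; rewrite ?expr0 ?expr1 ?opprK. Qed.

Lemma wedgeC i j w : wedge i (wedge j w) = - wedge j (wedge i w).
Proof.
apply/ffunP => I; rewrite extpN !ffunE.
have [->|ij] := eqVneq i j.
  by case: ifP => jI; rewrite ?inE ?eqxx /= ?scaler0 oppr0.
rewrite !inE [j == i]eq_sym ij /=.
case: ifP => iI; case: ifP => jI; rewrite ?scaler0 ?oppr0 //.
have -> : (I :\ j) :\ i = (I :\ i) :\ j by apply/setP => k; rewrite !inE andbCA.
rewrite !scalerA (esignD1 K i jI) (esignD1 K j iI) (sign_ltn_neq ij).
rewrite -scaleNr; congr (_ *: _).
by move: ((-1) ^+ _) (esign K i _) (esign K j _) => a b c; ring.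
Qed.

Lemma contractC i j w : contract i (contract j w) = - contract j (contract i w).
Proof.
apply/ffunP => I; rewrite extpN !ffunE.
have [->|ij] := eqVneq i j.
  by case: ifP => jI; rewrite ?inE ?eqxx /= ?scaler0 oppr0.
rewrite !inE [j == i]eq_sym (negPf ij) /=.
case: ifPn => iI; case: ifPn => jI; rewrite ?scaler0 ?oppr0 //.
have -> : i |: (j |: I) = j |: (i |: I) by rewrite setUCA.
have jI' := setU11 j I; have iI' := setU11 i I.
rewrite !scalerA (esignD1 K i jI') (esignD1 K j iI') !setU1K // (sign_ltn_neq ij).
rewrite -scaleNr; congr (_ *: _).
by move: ((-1) ^+ _) (esign K i I) (esign K j I) => a b c; ring.
Qed.

Section Combination.
Variables (a : 'I_n -> extp n V -> extp n V) (c : K) (x : 'I_n -> 'I_n -> K).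
Hypothesis aL : forall i, linear (a i).
Hypothesis aC : forall i j w, a i (a j w) = - a j (a i w).

Let b i w := c *: \sum_j x i j *: a j w.

Lemma combination_linear i : linear (b i).
Proof.
apply: (@linear_scaled _ _ _ _ (fun w => \sum_j x i j *: a j w)).
apply: (@linear_comb_sum _ _ _ _ _ _ (fun j w => x i j *: a j w)) => j.
exact: (@linear_scaled _ _ _ _ (a j)).
Qed.

Lemma combination_anticomm i j w : b i (b j w) = - b j (b i w).
Proof.
have E i' j' : b i' (b j' w) = c *: (c *: \sum_k \sum_l (x i' k * x j' l) *: a k (a l w)).
  rewrite /b; congr (_ *: _); rewrite [RHS]scaler_sumr; apply: eq_bigr => k _.
  rewrite (linear_scale (aL k)) (linear_bigsum (aL k)) scalerA mulrC -scalerA.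
  congr (_ *: _); rewrite scaler_sumr; apply: eq_bigr => l _.
  by rewrite (linear_scale (aL k)) scalerA.
rewrite !E -!scalerN; do 2 congr (_ *: _).
rewrite exchange_big -sumrN; apply: eq_bigr => k _; rewrite -sumrN; apply: eq_bigr => l _.
by rewrite aC scalerN mulrC.
Qed.

End Combination.

Lemma bigE_linear A i : linear (@bigE n K V pi A i).
Proof. exact: (combination_linear pi (fun i j => (A i j)%:R) wedge_linear). Qed.

Lemma bigEv_linear A i : linear (@bigEv n K V pi A i).
Proof. exact: (combination_linear pi^-1 (fun i j => ratr (invmx (ratmx A) j i)) contract_linear). Qed.

Lemma bigEC A i j w : bigE pi A i (bigE pi A j w) = - bigE pi A j (bigE pi A i w).
Proof. exact: (combination_anticomm pi (fun i j => (A i j)%:R) wedge_linear wedgeC). Qed.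

Lemma bigEvC A i j w : bigEv pi A i (bigEv pi A j w) = - bigEv pi A j (bigEv pi A i w).
Proof.
exact: (combination_anticomm pi^-1 (fun i j => ratr (invmx (ratmx A) j i)) contract_linear contractC).
Qed.

Lemma ratmx_unit A : zdet A != 0 -> ratmx A \in unitmx.
Proof.
move=> dA; rewrite unitmxE unitfE.
have -> : ratmx A = map_mx (fun z : int => z%:~R) (map_mx (fun k : nat => k%:Z) A).
  by rewrite -map_mx_comp; apply/matrixP => i j; rewrite !mxE.
by rewrite det_map_mx intr_eq0.
Qed.

Lemma ratmx_tr A : ratmx A^T = (ratmx A)^T.
Proof. by rewrite /ratmx map_trmx. Qed.

Lemma zdet_tr A : zdet A^T = zdet A.
Proof. by rewrite /zdet -map_trmx det_tr. Qed.

Lemma sum_mul_invmx A i j : zdet A != 0 ->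
  \sum_k (A i k)%:R * ratr (invmx (ratmx A) k j) = (i == j)%:R :> K.
Proof.
move=> dA; have /matrixP/(_ i j) := mulmxV (ratmx_unit dA).
rewrite !mxE => /(congr1 (@ratr K)); rewrite (ratr_sum0 K0) (ratr_nat0 K0) => <-.
by apply: eq_bigr => k _; rewrite (ratr_mul K0) mxE (ratr_nat0 K0).
Qed.

Lemma sum_invmx_mul A i j : zdet A != 0 ->
  \sum_k ratr (invmx (ratmx A) i k) * (A k j)%:R = (i == j)%:R :> K.
Proof.
move=> dA; have /matrixP/(_ i j) := mulVmx (ratmx_unit dA).
rewrite !mxE => /(congr1 (@ratr K)); rewrite (ratr_sum0 K0) (ratr_nat0 K0) => <-.
by apply: eq_bigr => k _; rewrite (ratr_mul K0) mxE (ratr_nat0 K0).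
Qed.

Lemma bigEv_bigE A i j w : bigEv pi A j (bigE pi A i w) =
  \sum_k \sum_l ((A i k)%:R * ratr (invmx (ratmx A) l j)) *: contract l (wedge k w).
Proof.
rewrite exchange_big /bigEv scaler_sumr; apply: eq_bigr => l _.
rewrite /bigE (linear_scale (contract_linear l)) (linear_bigsum (contract_linear l)).
rewrite !scalerA mulrAC mulVf // mul1r scaler_sumr; apply: eq_bigr => k _.
by rewrite (linear_scale (contract_linear l)) scalerA mulrC.
Qed.

(** The scalars pi and pi^-1 cancel, [wedge_contract] keeps only the diagonal terms, and an entry of
    A A^-1 remains: the two families are dual bases. *)
Lemma bigE_bigEv A i j w : zdet A != 0 ->
  bigE pi A i (bigEv pi A j w) + bigEv pi A j (bigE pi A i w) = if i == j then w else 0.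
Proof.
move=> dA; pose y k l : K := (A i k)%:R * ratr (invmx (ratmx A) l j).
have -> : bigE pi A i (bigEv pi A j w) = \sum_k \sum_l y k l *: wedge k (contract l w).
  rewrite /bigE scaler_sumr; apply: eq_bigr => k _.
  rewrite /bigEv (linear_scale (wedge_linear k)) (linear_bigsum (wedge_linear k)).
  rewrite !scalerA mulrAC mulfV // mul1r scaler_sumr; apply: eq_bigr => l _.
  by rewrite (linear_scale (wedge_linear k)) scalerA.
rewrite bigEv_bigE -big_split /=.
under eq_bigr => k _.
  rewrite -big_split /=.
  under eq_bigr => l _ do rewrite -scalerDr wedge_contract.
  rewrite (bigD1 k) //= eqxx big1 => [|l lk]; last first.
    by rewrite eq_sym (negPf lk) scaler0.
  rewrite addr0 /y; over.
by rewrite -scaler_suml sum_mul_invmx //; case: eqP => _; rewrite ?scale1r ?scale0r.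
Qed.

Lemma vac_linear : linear (@vac n K V).
Proof.
move=> c u v; apply/ffunP => I; rewrite extpD extpZ !ffunE; case: ifP => // _.
by rewrite scaler0 addr0.
Qed.

Section Star.
Variable A : 'M[nat]_n.
Hypothesis dA : zdet A != 0.

Let E := bigE (V := V) pi A^T.
Let Ev := bigEv (V := V) pi A^T.
Let dAT : zdet A^T != 0. Proof. by rewrite zdet_tr. Qed.

Let EL i : linear (E i). Proof. exact: bigE_linear. Qed.
Let EvL i : linear (Ev i). Proof. exact: bigEv_linear. Qed.
Let EC i j w : E i (E j w) = - E j (E i w). Proof. exact: bigEC. Qed.
Let EvC i j w : Ev i (Ev j w) = - Ev j (Ev i w). Proof. exact: bigEvC. Qed.
Let EEv i j w : E i (Ev j w) + Ev j (E i w) = if i == j then w else 0.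
Proof. exact: bigE_bigEv. Qed.

Definition star_basis I (v : V) : extp n V :=
  foldr Ev (foldr E (vac n v) (enum 'I_n)) (enum I).

Lemma star_basis_linear I : linear (star_basis I).
Proof.
apply: (@linear_comp _ _ _ _ (fun w => foldr Ev w (enum I))).
  by apply: foldr_linear => i; exact: bigEv_linear.
apply: (@linear_comp _ _ _ _ (fun w => foldr E w (enum 'I_n))); last exact: vac_linear.
by apply: foldr_linear => i; exact: bigE_linear.
Qed.

Lemma star_linear : linear (@star n K V pi A).
Proof.
apply: (@linear_comb_sum _ _ _ _ _ _ (fun I w => star_basis I (w I))) => I c u v.
by rewrite extpD extpZ star_basis_linear.
Qed.

Lemma bigEv_star_basis i I v :
  Ev i (star_basis I v) = if i \in I then 0 else esign K i I *: star_basis (i |: I) v.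
Proof.
case: ifPn => iI.
  by apply: (anticomm_foldr_mem EvL EvC K2); rewrite mem_enum.
have enumE J : enum J = [seq j <- enum 'I_n | j \in J] by rewrite enumT.
rewrite /star_basis !enumE (anticomm_foldr_setU1 EvL EvC) ?mem_enum //; last first.
  by rewrite val_enum_ord iota_ltn_sorted.
rewrite scalerA -size_filter /esign cardE enumE.
rewrite (_ : size _ = size [seq j <- enum 'I_n | (j \in I) && (j < i)%N]); last first.
  by congr size; apply: eq_filter => j; rewrite inE.
by rewrite -expr2 sqrr_sign scale1r.
Qed.

(** Every E_i kills the top product E_1 ... E_n and anticommutes with E_j^v for j <> i, which
    settles i outside I. For i in I, the relation E_i E_i^v + E_i^v E_i = 1 strips the factor
    E_i^v. *)
Lemma bigE_star_basis i I v :
  E i (star_basis I v) = if i \in I then esign K i I *: star_basis (I :\ i) v else 0.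
Proof.
have H J : i \notin J -> E i (star_basis J v) = 0.
  rewrite -mem_enum /star_basis; elim: (enum J) => [|j s IH] /=.
    move=> _; apply: (anticomm_foldr_mem EL EC K2).
    by rewrite mem_enum.
  rewrite inE negb_or => /andP[ij /IH Es].
  have := EEv i j (foldr Ev (foldr E (vac n v) (enum 'I_n)) s).
  rewrite (negPf ij) Es (linear_0 (EvL _)) addr0.
  by [].
case: ifPn => iI; last exact: H.
have iI' : i \notin I :\ i by rewrite setD11.
have := bigEv_star_basis i (I :\ i) v; rewrite setD11 setD1K // => EvE.
have := EEv i i (star_basis (I :\ i) v); rewrite eqxx.
rewrite H // (linear_0 (EvL _)) addr0 EvE (linear_scale (EL _)) => <-.
by rewrite scalerA (esignD1 K i iI) ltnn mul1r -expr2 sqrr_sign scale1r.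
Qed.

Lemma star_wedge i w : star pi A (wedge i w) = Ev i (star pi A w).
Proof.
rewrite [in RHS]/star (linear_bigsum (EvL i)).
rewrite /star (bigID (fun I => i \in I)) /= [X in _ + X]big1 => [|I iI]; last first.
  by rewrite ffunE (negPf iI); exact: (linear_0 (star_basis_linear _)).
rewrite [RHS](bigID (fun I => i \in I)) /= [X in _ = X + _]big1 => [|I iI]; last first.
  by have := bigEv_star_basis i I (w I); rewrite iI => {}iI; exact: iI.
rewrite addr0 add0r (reindex_onto (fun I => i |: I) (fun I => I :\ i)) /=; last first.
  by move=> I iI; rewrite setD1K.
apply: eq_big => [I|I /andP[_ /eqP iI]].
  rewrite setU11; apply/eqP/idP => [<-|iI]; [by rewrite setD11 | by rewrite setU1K].
have {}iI : i \notin I by rewrite -iI setD11.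
have := bigEv_star_basis i I (w I); rewrite (negPf iI) => ->.
rewrite ffunE setU11 setU1K // (esignD1 K i (setU11 i I)) ltnn mul1r setU1K //.
exact: (linear_scale (star_basis_linear _)).
Qed.

Lemma star_contract i w : star pi A (contract i w) = E i (star pi A w).
Proof.
rewrite [in RHS]/star (linear_bigsum (EL i)).
rewrite /star (bigID (fun I => i \in I)) /= [X in X + _]big1 => [|I iI]; last first.
  by rewrite ffunE iI; exact: (linear_0 (star_basis_linear _)).
rewrite [RHS](bigID (fun I => i \in I)) /= [X in _ = _ + X]big1 => [|I iI]; last first.
  by have := bigE_star_basis i I (w I); rewrite (negPf iI) => {}iI; exact: iI.
rewrite add0r addr0 [RHS](reindex_onto (fun I => i |: I) (fun I => I :\ i)) /=; last first.
  by move=> I iI; rewrite setD1K.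
apply: eq_big => [I|I iI].
  rewrite setU11; apply/idP/eqP => [iI|<-]; [by rewrite setU1K | by rewrite setD11].
have := bigE_star_basis i (i |: I) (w (i |: I)); rewrite setU11 setU1K // => ->.
rewrite ffunE (negPf iI) (esignD1 K i (setU11 i I)) ltnn mul1r setU1K //.
exact: (linear_scale (star_basis_linear _)).
Qed.

Lemma star_bigE i w : star pi A (bigE pi A i w) = contract i (star pi A w).
Proof.
rewrite /bigE (linear_scale star_linear) (linear_bigsum star_linear) scaler_sumr.
under eq_bigr => j _.
  rewrite (linear_scale star_linear) star_wedge /Ev /bigEv !scalerA.
  rewrite mulrAC mulfV // mul1r scaler_sumr.
  under eq_bigr => k _ do rewrite scalerA ratmx_tr -trmx_inv mxE.
  over.
rewrite exchange_big (bigD1 i) //= [X in _ + X]big1 => [|k ki].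
  by rewrite addr0 -scaler_suml sum_mul_invmx // eqxx scale1r.
by rewrite -scaler_suml sum_mul_invmx // eq_sym (negPf ki) scale0r.
Qed.

Lemma star_bigEv i w : star pi A (bigEv pi A i w) = wedge i (star pi A w).
Proof.
rewrite /bigEv (linear_scale star_linear) (linear_bigsum star_linear) scaler_sumr.
under eq_bigr => j _.
  rewrite (linear_scale star_linear) star_contract /E /bigE !scalerA.
  rewrite mulrAC mulVf // mul1r scaler_sumr.
  under eq_bigr => k _ do rewrite scalerA mxE mulrC.
  over.
rewrite exchange_big (bigD1 i) //= [X in _ + X]big1 => [|k ki].
  by rewrite addr0 -scaler_suml sum_mul_invmx // eqxx scale1r.
by rewrite -scaler_suml sum_mul_invmx // (negPf ki) scale0r.
Qed.

End Star.

Lemma lift_linear (T : V -> V) : linear T -> linear (@lift n K V T).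
Proof. by move=> TL c u v; apply/ffunP => I; rewrite extpD extpZ !ffunE TL. Qed.

Section Lift.
Variable T : V -> V.
Hypothesis TL : linear T.

Lemma lift_wedge i w : lift T (wedge i w) = wedge i (lift T w).
Proof.
apply/ffunP => I; rewrite !ffunE; case: ifP => _; last exact: linear_0.
by rewrite (linear_scale TL).
Qed.

Lemma lift_contract i w : lift T (contract i w) = contract i (lift T w).
Proof.
apply/ffunP => I; rewrite !ffunE; case: ifP => _; first exact: linear_0.
by rewrite (linear_scale TL).
Qed.

Lemma lift_bigE A i w : lift T (bigE pi A i w) = bigE pi A i (lift T w).
Proof.
have LL := lift_linear TL.
rewrite /bigE (linear_scale LL) (linear_bigsum LL); congr (_ *: _).
by apply: eq_bigr => j _; rewrite (linear_scale LL) lift_wedge.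
Qed.

Lemma lift_bigEv A i w : lift T (bigEv pi A i w) = bigEv pi A i (lift T w).
Proof.
have LL := lift_linear TL.
rewrite /bigEv (linear_scale LL) (linear_bigsum LL); congr (_ *: _).
by apply: eq_bigr => j _; rewrite (linear_scale LL) lift_contract.
Qed.

Lemma lift_star A w : lift T (star pi A w) = star pi A (lift T w).
Proof.
rewrite /star (linear_bigsum (lift_linear TL)); apply: eq_bigr => I _.
elim: (enum I) => /= [|i s IH]; last by rewrite lift_bigEv IH.
elim: (enum 'I_n) => /= [|i s IH]; last by rewrite lift_bigE IH.
by apply/ffunP => J; rewrite !ffunE; case: ifP => // _; exact: linear_0.
Qed.

End Lift.

Lemma extdegE w I : extdeg w I = (#|I|)%:R *: w I.
Proof.
rewrite /extdeg extp_sum (bigID (fun i => i \in I)) /= [X in _ + X]big1 => [|i iI]; last first.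
  by rewrite ffunE (negPf iI).
rewrite addr0 -sum1_card natr_sum scaler_suml; apply: eq_bigr => i iI.
rewrite !ffunE iI setD11 setD1K // scalerA (esignD1 K i iI) ltnn mul1r.
by rewrite -expr2 sqrr_sign.
Qed.

(** The image of sum_i e_i e_i^v is sum_i E_i^v E_i for the transpose. This sum does not depend on
    the choice of dual bases, so it equals sum_i e_i^v e_i = n - ext. *)
Lemma star_extdeg A w : zdet A != 0 ->
  star pi A (extdeg w) = star pi A w *+ n - extdeg (star pi A w).
Proof.
move=> dA; have dAT : zdet A^T != 0 by rewrite zdet_tr.
have sumE (u : extp n V) : \sum_i bigEv pi A^T i (bigE pi A^T i u) = \sum_i contract i (wedge i u).
  under eq_bigr do rewrite bigEv_bigE.
  rewrite exchange_big; apply: eq_bigr => k _; rewrite exchange_big (bigD1 k) //=.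
  have sumA l : \sum_i ((A^T i k)%:R * ratr (invmx (ratmx A^T) l i)) = (l == k)%:R :> K.
    by rewrite -(sum_invmx_mul _ _ dAT); apply: eq_bigr => i _; rewrite mulrC.
  rewrite [X in _ + X]big1 ?addr0 => [|l lk]; rewrite -scaler_suml sumA.
    by rewrite eqxx scale1r.
  by rewrite (negPf lk) scale0r.
rewrite /extdeg (linear_bigsum (star_linear _)).
under eq_bigr => i _ do rewrite star_wedge // star_contract //.
rewrite sumE; apply: (canRL (addrK _)); rewrite -big_split /=.
under eq_bigr => i _ do rewrite addrC wedge_contract eqxx.
by rewrite sumr_const card_ord.
Qed.

End ExteriorTheory.

(** * Frobenius and the differentials *)

Section FrobeniusCommutation.
Variables (p : nat) (K : closedFieldType) (pi : K) (n : nat).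
Hypothesis p_prime : prime p.
Hypothesis K0 : [pchar K] =i pred0.
Hypothesis pi0 : pi != 0.
Implicit Types (A : 'M[nat]_n) (i j : 'I_n) (f g : series n K) (m : mono n).

Lemma seriesD f g m : (f + g) m = f m + g m. Proof. by []. Qed.
Lemma seriesN f m : (- f) m = - f m. Proof. by []. Qed.
Lemma seriesZ c f m : (c *: f) m = c * f m. Proof. by []. Qed.
Lemma series_sum (T : Type) (s : seq T) (P : pred T) (F : T -> series n K) m :
  (\sum_(t <- s | P t) F t) m = \sum_(t <- s | P t) F t m.
Proof. by elim/big_rec2: _ => // t y x _ <-. Qed.

Definition Theta A f : series n K := Theta2 p pi A (Theta1 p f).

Lemma Theta2_conv A f m :
  Theta2 p pi A f m =
  conv (Z p pi A) (fun u => conv (Z p pi A^T) (fun v => f (u, v)) m.2) m.1.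
Proof.
apply: eq_bigr => u _; rewrite mulr_sumr; apply: eq_bigr => v _.
by rewrite mulrA.
Qed.

Lemma convDr (a b c : 'X_{1..n} -> K) k :
  conv a (fun u => b u + c u) k = conv a b k + conv a c k.
Proof. by rewrite -big_split; apply: eq_bigr => u _; rewrite mulrDr. Qed.

Lemma conv_subl (a b f : 'X_{1..n} -> K) c k :
  conv (fun u => c * a u - b u) f k = c * conv a f k - conv b f k.
Proof. by rewrite mulr_sumr -sumrB; apply: eq_bigr => u _; rewrite mulrBl mulrA. Qed.

Lemma convZr (a b : 'X_{1..n} -> K) c k :
  conv a (fun u => c * b u) k = c * conv a b k.
Proof. by rewrite mulr_sumr; apply: eq_bigr => u _; rewrite mulrCA. Qed.

Lemma conv_sumr (J : finType) (a : 'X_{1..n} -> K) (b : J -> 'X_{1..n} -> K) k :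
  conv a (fun u => \sum_j b j u) k = \sum_j conv a (b j) k.
Proof. by rewrite exchange_big; apply: eq_bigr => u _; rewrite mulr_sumr. Qed.

Lemma conv_mcoeffsX (r : 'X_{1..n}) (a : 'X_{1..n} -> K) k :
  conv (mcoeffs 'X_[r]) a k = shift r a k.
Proof.
rewrite (@convE _ _ 'X_[r] (trunc (mdeg k).+1 a)) => [|//|l lk]; last exact: mcoeff_trunc.
rewrite mcoeffXM /shift; case: ifP => // _.
by rewrite /mcoeffs mcoeff_trunc ?lem_subr.
Qed.

Lemma Theta1_linear : linear (@Theta1 p K n).
Proof.
by move=> c f g; apply: boolp.funext => m; rewrite !seriesD !seriesZ /Theta1; case: ifP; rewrite ?seriesD ?seriesZ ?mulr0 ?addr0.
Qed.

Lemma Theta2_linear A : linear (Theta2 (K := K) p pi A).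
Proof.
move=> c f g; apply: boolp.funext => m; rewrite seriesD seriesZ !Theta2_conv.
rewrite -convZr -convDr; apply: eq_conv_le => // u _.
by rewrite -convZr -convDr.
Qed.

Lemma Theta_linear A : linear (Theta A).
Proof. by move=> c f g; rewrite /Theta Theta1_linear Theta2_linear. Qed.

Lemma mshiftx r f m : mshift (r, 0%MM) f m = shift r (fun u => f (u, m.2)) m.1.
Proof.
rewrite /mshift /shift /= subm0; have -> : (0 <= m.2)%MM by apply/mnm_lepP => i; rewrite mnm0E.
by rewrite andbT.
Qed.

Lemma mshift_swap (u : mono n) f m :
  mshift u (Dswap f) m = mshift (u.2, u.1) f (m.2, m.1).
Proof. by rewrite /mshift /= andbC. Qed.

(** The chain rule for x -> x^p; it accounts for the factor p in the commutation rules. *)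
Lemma Theta1_euler i f m : p%:R * Theta1 p (theta i f) m = (m.1 i)%:R * Theta1 p f m.
Proof.
rewrite /Theta1; case: ifP => [/forallP/(_ i)/andP[pm _]|_]; last by rewrite !mulr0.
by rewrite /theta mnmE mulrA -natrM mulnC divnK.
Qed.

Lemma Theta1_mshift r f m :
  Theta1 p (mshift (r, 0%MM) f) m = shift (r *+ p)%MM (fun u => Theta1 p f (u, m.2)) m.1.
Proof.
have pp := prime_gt0 p_prime.
rewrite /Theta1 mshiftx /shift /=.
case: forallP => pm.
  have pm1 j : (p %| m.1 j)%N by case/andP: (pm j).
  have -> : (r <= [multinom (m.1 j %/ p)%N | j < n])%MM = (r *+ p <= m.1)%MM.
    apply/mnm_lepP/mnm_lepP => H j; have := H j; rewrite mnmE mulmnE leq_divRL //.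
  case: ifP => // rm; case: forallP => [_|[]]; last first.
    move=> j; case/andP: (pm j) => p1 p2; rewrite p2 andbT mnmBE mulmnE.
    by rewrite dvdn_subl ?dvdn_mull //; move/mnm_lepP: rm => /(_ j); rewrite mulmnE.
  congr (f (_, _)); apply/mnmP => j; rewrite !mnmE.
  by rewrite mulmnE divnBr ?dvdn_mull // mulnK.
case: ifP => // rm; case: forallP => // H; case: pm => j; have /andP[+ p2] := H j.
rewrite p2 andbT mnmBE mulmnE => p1.
have rj : (r j * p <= m.1 j)%N by move/mnm_lepP: rm => /(_ j); rewrite mulmnE.
by rewrite -(subnK rj) dvdn_add // dvdn_mull.
Qed.

Section Rows.
Variable A : 'M[nat]_n.
Hypothesis A0 : forall i, mrow A i != 0%MM.

Lemma euler_Z i u : euler i (Z p pi A) u =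
  \sum_j (pi * (A j i)%:R) * (p%:R * shift (mrow A j *+ p)%MM (Z p pi A) u - shift (mrow A j) (Z p pi A) u).
Proof.
rewrite [LHS](euler_mexp K0 _ _ (Z_const p_prime pi A0)) Z_mexp.
set P := 'X_i * _.
have PE k : mcoeffs P k = \sum_j (pi * (A j i)%:R) *
    mcoeffs (p%:R *: 'X_[(mrow A j *+ p)%MM] - 'X_[mrow A j]) k.
  rewrite /mcoeffs /P raddf_sum mulr_sumr raddf_sum; apply: eq_bigr => j _ /=.
  rewrite -mcoeffZ; congr (_@__).
  have XX r : 'X_i * ('X_[r] : {mpoly K[n]})^`M(i) = (r i)%:R *: 'X_[r].
    apply/mpolyP => l; rewrite mcoeff_euler mcoeffZ /euler /mcoeffs mcoeffX.
    by case: eqP => [->|] //; rewrite !mulr0.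
  rewrite mpolyXn mderivZ mderivB -scalerAr mulrBr !XX mulmnE mnmE natrM.
  by rewrite -!scalerA -scalerBr scalerA.
rewrite (eq_conv_le (f' := Z p pi A) (fun k _ => PE k)) => [|k _]; last by rewrite /Z Z_mexp.
rewrite (conv_suml (fun j => pi * (A j i)%:R) (fun j => mcoeffs (p%:R *: 'X_[(mrow A j *+ p)%MM] - 'X_[mrow A j]))).
apply: eq_bigr => j _; congr (_ * _).
rewrite -!conv_mcoeffsX -conv_subl; apply: eq_conv_le => // k _.
by rewrite /mcoeffs mcoeffB mcoeffZ.
Qed.

(** Differentiating [Z] produces p x^(p r_j) - x^(r_j) for each row r_j. The second part cancels
    [phi] on the left; the first is p times [phi] carried through x -> x^p. *)
Lemma theta_phi_Theta i f :
  theta i (Theta A f) + phi pi A i (Theta A f) = p%:R *: Theta A (theta i f + phi pi A i f).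
Proof.
apply: boolp.funext => m; pose F (u v : 'X_{1..n}) := Theta1 p f (u, v).
(* The y-exponent is inert: G performs the convolution in y at the fixed exponent [m.2], which
   leaves a computation in x alone. *)
pose G u := conv (Z p pi A^T) (F u) m.2.
have ThE u : Theta A f (u, m.2) = conv (Z p pi A) G u by exact: Theta2_conv.
have phiE g : phi pi A i g m = \sum_j (pi * (A j i)%:R) * shift (mrow A j) (fun u => g (u, m.2)) m.1.
  rewrite /phi seriesZ series_sum mulr_sumr; apply: eq_bigr => j _.
  by rewrite seriesZ mshiftx mulrA.
rewrite seriesD seriesZ phiE.
have -> : theta i (Theta A f) m = euler i (conv (Z p pi A) G) m.1.
  by rewrite /theta /euler -ThE; case: (m).
rewrite euler_conv.
rewrite (eq_conv_le (f' := G) (fun k _ => euler_Z i k)) // conv_suml.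
have -> : p%:R * Theta A (theta i f + phi pi A i f) m =
    conv (Z p pi A) (fun u => euler i G u + \sum_j (pi * (A j i)%:R) * (p%:R * shift (mrow A j *+ p)%MM G u)) m.1.
  rewrite /Theta Theta2_conv -convZr; apply: eq_conv_le => // u _.
  have Th1 v : p%:R * Theta1 p (theta i f + phi pi A i f) (u, v) =
      (u i)%:R * F u v + \sum_j (pi * (A j i)%:R) * (p%:R * shift (mrow A j *+ p)%MM (F^~ v) u).
    rewrite (linear_add Theta1_linear) seriesD mulrDr Theta1_euler; congr (_ + _).
    rewrite /phi (linear_scale Theta1_linear) (linear_bigsum Theta1_linear) seriesZ series_sum.
    rewrite mulrCA mulr_sumr mulr_sumr; apply: eq_bigr => j _.
    rewrite (linear_scale Theta1_linear) seriesZ Theta1_mshift.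
    by rewrite -[RHS]mulrA; congr (pi * _); rewrite mulrCA.
  rewrite -convZr (eq_conv_le (a' := Z p pi A^T) _ (fun v _ => Th1 v)) //.
  rewrite convDr convZr conv_sumr; congr (_ + _); apply: eq_bigr => j _.
  rewrite !convZr; congr (_ * (_ * _)); rewrite /shift; case: ifP => // _.
  by rewrite /conv big1 // => v _; rewrite mulr0.
rewrite convDr conv_sumr addrAC [RHS]addrC; congr (_ + _).
rewrite -big_split; apply: eq_bigr => j _ /=.
rewrite !convZr conv_shiftr -mulrDr; congr (_ * _).
have -> : shift (mrow A j) (fun u => Theta A f (u, m.2)) m.1 = shift (mrow A j) (conv (Z p pi A) G) m.1.
  by rewrite /shift; case: ifP.
by rewrite conv_subl !conv_shiftl subrK.
Qed.

End Rows.

Lemma Dswap_linear : linear (@Dswap K n).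
Proof. by []. Qed.

Lemma Theta_Dswap A f : Dswap (Theta A f) = Theta A^T (Dswap f).
Proof.
have T1 : Theta1 p (Dswap f) = Dswap (Theta1 p f).
  apply: boolp.funext => m; rewrite /Theta1 /Dswap /=; congr (if _ then _ else _).
  by apply: eq_forallb => j; rewrite andbC.
rewrite /Theta T1; apply: boolp.funext => m.
rewrite /Dswap /Theta2 /= exchange_big /=; apply: eq_bigr => u _.
by apply: eq_bigr => v _; rewrite trmxK [Z _ _ _ _ * Z _ _ _ _]mulrC.
Qed.

Lemma ratr_ywt A i m :
  ratr (ywt A m 0 i) = \sum_j (m.2 j)%:R * ratr (invmx (ratmx A^T) j i) :> K.
Proof.
rewrite mxE (ratr_sum0 K0) ratmx_tr; apply: eq_bigr => j _.
by rewrite (ratr_mul K0) mxE (ratr_nat0 K0).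
Qed.

(** Reduces the y-side to the x-side: the inverse of A^T turns the exponents of y into [ywt] and
    cancels the entries of A^T inside [phi], so that a single shift survives. *)
Lemma Tv_psivE A i f : zdet A != 0 ->
  Tv pi A i f + psiv A i f =
  pi^-1 *: \sum_j ratr (invmx (ratmx A^T) j i) *:
    Dswap (theta j (Dswap f) + phi pi A^T j (Dswap f)).
Proof.
move=> dA; have dAT : zdet A^T != 0 by rewrite zdet_tr.
apply: boolp.funext => m; rewrite seriesD seriesZ series_sum.
have E j : (ratr (invmx (ratmx A^T) j i) *: Dswap (theta j (Dswap f) + phi pi A^T j (Dswap f))) m =
    (m.2 j)%:R * ratr (invmx (ratmx A^T) j i) * f m +
    pi * \sum_k ((A^T k j)%:R * ratr (invmx (ratmx A^T) j i)) * psiv A k f m.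
  rewrite seriesZ /Dswap seriesD /= mulrDr /theta /=; congr (_ + _).
    by case: (m) => u v /=; rewrite mulrA [ratr _ * _]mulrC.
  rewrite /phi seriesZ series_sum mulrCA mulr_sumr; congr (_ * _); apply: eq_bigr => k _.
  rewrite seriesZ [mshift _ _ _]mshift_swap /= /psiv; case: (m) => u v /=.
  by rewrite mulrA [ratr _ * _]mulrC.
under eq_bigr do rewrite E.
rewrite big_split -mulr_suml -ratr_ywt -mulr_sumr mulrDr; congr (_ + _); first by rewrite mulrA.
rewrite mulKf //.
rewrite exchange_big (bigD1 i) //= [X in _ + X]big1 => [|k ki].
  by rewrite addr0 -mulr_suml sum_mul_invmx // eqxx mul1r.
by rewrite -mulr_suml sum_mul_invmx // (negPf ki) mul0r.
Qed.

Lemma Tv_psiv_Theta A i f : zdet A != 0 -> (forall i, mrow A^T i != 0%MM) ->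
  Tv pi A i (Theta A f) + psiv A i (Theta A f) = p%:R *: Theta A (Tv pi A i f + psiv A i f).
Proof.
move=> dA A0; rewrite !Tv_psivE // (linear_scale (Theta_linear A)) (linear_bigsum (Theta_linear A)).
rewrite scalerA mulrC -scalerA; congr (_ *: _); rewrite scaler_sumr; apply: eq_bigr => j _.
move: (ratr _) => a; rewrite (linear_scale (Theta_linear A)) scalerA mulrC -scalerA; congr (_ *: _).
rewrite Theta_Dswap theta_phi_Theta // (linear_scale Dswap_linear) Theta_Dswap trmxK.
by [].
Qed.

End FrobeniusCommutation.

(** * Spaces of overconvergent series *)

Lemma sum_neq0 (K : nmodType) (T : finType) (P : pred T) (F : T -> K) :
  \sum_(t | P t) F t != 0 -> exists t, P t && (F t != 0).
Proof.
move=> sN0; apply/existsP; apply: contraNT sN0; rewrite negb_exists => /forallP H.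
by rewrite big1 // => t Pt; have := H t; rewrite Pt /= negbK => /eqP.
Qed.

Section Overconvergence.
Variables (p : nat) (R : realType) (K : closedFieldType) (ord : K -> \bar R).
Hypotheses (p_prime : prime p) (Cp : is_Cp p ord).
Variables (n : nat) (pi : K).
Hypothesis pi_root : pi ^+ p.-1 = - p%:R.
Implicit Types (A : 'M[nat]_n) (f g : series n K) (m u : mono n) (S : mono n -> Prop).

Definition ddeg m : nat := (mdeg m.1 + mdeg m.2)%N.

Definition shiftm m u : mono n := ((m.1 + u.1)%MM, (m.2 + u.2)%MM).

(** An additive constant is easier to propagate than a finite set of exceptions. Going back costs
    half the slope: M d - C >= (M / 2) d once d >= 2 C / M, and finitely many monomials have smaller
    degree. *)
Lemma overconvergentP f :
  overconvergent ord f <->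
  exists2 M : R, 0 < M & exists C, forall m, vge ord (M * (ddeg m)%:R - C) (f m).
Proof.
split=> [[M M0 [s Ms]]|[M M0 [C MC]]].
  exists M => //.
  have [C [C0 sC]] : exists C : R, 0 <= C /\
      forall m, m \in s -> vge ord (M * (ddeg m)%:R - C) (f m).
    elim: s {Ms} => [|u s [C [C0 sC]]]; first by exists 0.
    have [c c0 /(_ tt) uc] := vge_bound Cp (fun _ : unit => f u).
    exists (C + c + M * (ddeg u)%:R); split=> [|m].
      by rewrite !addr_ge0 // mulr_ge0 // ltW.
    rewrite inE => /predU1P[->|/sC]; first by apply: vgeW uc; lra.
    apply: vgeW; have : 0 <= M * (ddeg u)%:R by rewrite mulr_ge0 // ltW.
    by lra.
  exists C => m; have [/sC//|/Ms] := boolP (m \in s).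
  by apply: vgeW; rewrite lerBlDr lerDl.
exists (M / 2); first by lra.
pose D := Num.bound `|2 * C / M|.
exists [seq (val a, val b) | a <- enum {: 'X_{1..n < D}}, b <- enum {: 'X_{1..n < D}}] => m ms.
have mD : (D <= ddeg m)%N.
  rewrite leqNgt; apply: contra ms => mD.
  have m1 : (mdeg m.1 < D)%N by apply: leq_ltn_trans mD; exact: leq_addr.
  have m2 : (mdeg m.2 < D)%N by apply: leq_ltn_trans mD; exact: leq_addl.
  apply/allpairsP; exists (BMultinom m1, BMultinom m2); rewrite !mem_enum; split=> //.
  exact: surjective_pairing.
apply: le_trans (MC m); rewrite lee_fin -/(ddeg m).
have : 2 * C / M <= (ddeg m)%:R.
  apply: le_trans (_ : D%:R <= _); last by rewrite ler_nat.
  by apply: le_trans (ler_norm _) _; exact/ltW/archi_boundP/normr_ge0.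
rewrite ler_pdivrMr // => H; have : (ddeg m)%:R * M = M * (ddeg m)%:R by rewrite mulrC.
by lra.
Qed.

(** The common shape of [Rtilde], [Rideal] and [Stilde], with [Ymono], [Imono] and [Smono] as S, so
    that each closure property is proved once. *)
Definition oc_on S f : Prop := supported S f /\ overconvergent ord f.

Lemma oc_on_sub S S' f : (forall m, S m -> S' m) -> oc_on S f -> oc_on S' f.
Proof. by move=> SS' [Sf fo]; split=> // m /Sf /SS'. Qed.

Lemma oc_on0 S : oc_on S 0.
Proof.
split=> [m|]; first by rewrite eqxx.
by apply/overconvergentP; exists 1 => //; exists 0 => m; exact: (vge0 Cp).
Qed.

Lemma oc_onD S f g : oc_on S f -> oc_on S g -> oc_on S (f + g).
Proof.
move=> [Sf /overconvergentP[M M0 [C MC]]] [Sg /overconvergentP[M' M'0 [C' MC']]]; split.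
  move=> m; rewrite seriesD; have [f0|/Sf //] := eqVneq (f m) 0.
  by rewrite f0 add0r => /Sg.
apply/overconvergentP; exists (Num.min M M'); first by rewrite lt_min M0.
exists (Num.max C C') => m; apply: (vgeD Cp).
  by apply: vgeW (MC m); rewrite lerB ?le_max ?lexx // ler_wpM2r // ge_min lexx.
by apply: vgeW (MC' m); rewrite lerB ?le_max ?lexx ?orbT // ler_wpM2r // ge_min lexx orbT.
Qed.

Lemma oc_on_diag S (d : mono n -> K) C f :
  (forall m, vge ord (- C) (d m)) -> oc_on S f -> oc_on S (fun m => d m * f m).
Proof.
move=> dC [Sf /overconvergentP[M M0 [C' MC]]]; split.
  by move=> m; rewrite mulf_eq0 negb_or => /andP[_ /Sf].
apply/overconvergentP; exists M => //; exists (C + C') => m.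
by apply: vgeW (vgeM Cp (dC m) (MC m)); lra.
Qed.

Lemma oc_onZ S c f : oc_on S f -> oc_on S (c *: f).
Proof.
have [C _ /(_ tt) cC] := vge_bound Cp (fun _ : unit => c).
exact: (@oc_on_diag S (fun _ => c) C).
Qed.

Lemma oc_onB S f g : oc_on S f -> oc_on S g -> oc_on S (f - g).
Proof. by move=> Sf Sg; apply: oc_onD => //; rewrite -scaleN1r; exact: oc_onZ. Qed.

Lemma oc_on_sum S (T : Type) (s : seq T) (P : pred T) (F : T -> series n K) :
  (forall t, P t -> oc_on S (F t)) -> oc_on S (\sum_(t <- s | P t) F t).
Proof.
by move=> SF; elim/big_rec: _ => [|t f Pt]; [exact: oc_on0 | apply: oc_onD; exact: SF].
Qed.

Lemma oc_on_mshift S u f : (forall m, S m -> S (shiftm m u)) ->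
  oc_on S f -> oc_on S (mshift u f).
Proof.
move=> Su [Sf /overconvergentP[M M0 [C MC]]]; split.
  move=> m; rewrite /mshift; case: ifP => [/andP[u1 u2] /Sf /Su|]; last by rewrite eqxx.
  by rewrite /shiftm /= !submK //; case: (m).
apply/overconvergentP; exists M => //; exists (M * (ddeg u)%:R + C) => m.
rewrite /mshift; case: ifP => [/andP[u1 u2]|_]; last exact: (vge0 Cp).
apply: vgeW (MC _); rewrite /ddeg /= -(mdeg_subm u1) -(mdeg_subm u2) !natrD; lra.
Qed.

Lemma oc_on_Dswap S f : oc_on S f -> oc_on (fun m => S (m.2, m.1)) (Dswap f).
Proof.
move=> [Sf /overconvergentP[M M0 [C MC]]]; split=> [m /Sf//|].
apply/overconvergentP; exists M => //; exists C => m.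
by apply: vgeW (MC _); rewrite /ddeg /= addnC.
Qed.

Lemma oc_on_Theta S S' A f :
  (forall i, mrow A i != 0%MM) -> (forall i, mrow A^T i != 0%MM) ->
  (forall m u, S m -> Z p pi A u.1 != 0 -> Z p pi A^T u.2 != 0 ->
     S' (shiftm ((m.1 *+ p)%MM, (m.2 *+ p)%MM) u)) ->
  oc_on S f -> oc_on S' (Theta p pi A f).
Proof.
move=> A0 AT0 SS' [Sf /overconvergentP[M M0 [C MC]]].
have p0 := prime_gt0 p_prime.
have T1 m : Theta1 p f m != 0 -> exists2 m', f m' != 0 & m = ((m'.1 *+ p)%MM, (m'.2 *+ p)%MM).
  rewrite /Theta1; case: forallP => [pm fm|_]; last by rewrite eqxx.
  eexists; first exact: fm.
  by case: (m) pm => m1 m2 /= pm; congr (_, _); apply/mnmP => j;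
    rewrite mulmnE mnmE divnK //; case/andP: (pm j).
split.
  move=> m; rewrite /Theta /Theta2 => ThN0.
  have [u [v [[um vm] Zu Zv fN0]]] : exists u v : 'X_{1..n}, [/\ (u <= m.1)%MM /\ (v <= m.2)%MM,
      Z p pi A u != 0, Z p pi A^T v != 0 & Theta1 p f ((m.1 - u)%MM, (m.2 - v)%MM) != 0].
    have [u /andP[um uN0]] := sum_neq0 ThN0.
    have [v /andP[vm vN0]] := sum_neq0 uN0.
    by move: vN0; rewrite !mulf_eq0 !negb_or -andbA => /and3P[]; exists u, v.
  have [m' /Sf Sm' [m1 m2]] := T1 _ fN0.
  have := SS' m' (u, v) Sm' Zu Zv; rewrite /shiftm /= -m1 -m2 !submK //.
  by case: (m).
have [e e0 Ze] := slope_Z p_prime Cp pi_root A0.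
have [e' e'0 Ze'] := slope_Z p_prime Cp pi_root AT0.
have pR : 0 < p%:R :> R by rewrite ltr0n.
(* Raising variables to the p-th power divides the slope of f by p; the two factors [Z] have slopes
   e and e' without constant, so C is unchanged. *)
pose mu := Num.min (M / p%:R) (Num.min e e').
have muM : mu <= M / p%:R by rewrite ge_min lexx.
have mue : mu <= e by rewrite !ge_min lexx !orbT.
have mue' : mu <= e' by rewrite !ge_min lexx !orbT.
apply/overconvergentP; exists mu; first by rewrite !lt_min divr_gt0 ?e0.
exists C => m; apply: (vge_sum Cp) => u um; apply: (vge_sum Cp) => v vm.
have Zu := slope_le mue Ze u; have Zv := slope_le mue' Ze' v.
have Tf l : vge ord (mu * (ddeg l)%:R - C) (Theta1 p f l).
  have [->|/T1[m' _ lE]] := eqVneq (Theta1 p f l) 0; first exact: (vge0 Cp).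
  suff -> : Theta1 p f l = f m'.
    apply: vgeW (MC m'); rewrite lerD2r lE /ddeg /= !mdegMn -mulnDl natrM.
    rewrite mulrA mulrAC ler_wpM2r //.
    by rewrite -ler_pdivlMr.
  rewrite lE /Theta1; case: forallP => [_|[j]]; last first.
    by rewrite !mulmnE !dvdn_mull.
  congr (f _); case: (m') => m1 m2 /=.
  by congr (_, _); apply/mnmP => j; rewrite mnmE mulmnE mulnK.
apply: vgeW (vgeM Cp (vgeM Cp Zu Zv) (Tf _)).
have Du : (mdeg m.1)%:R = (mdeg u)%:R + (mdeg (m.1 - u))%:R :> R by rewrite -natrD mdeg_subm.
have Dv : (mdeg m.2)%:R = (mdeg v)%:R + (mdeg (m.2 - v))%:R :> R by rewrite -natrD mdeg_subm.
by rewrite /ddeg /= !natrD Du Dv; lra.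
Qed.

End Overconvergence.

(** * Weights of monomials *)

Section Weights.
Variables (n : nat) (A : 'M[nat]_n).
Hypothesis detA : zdet A != 0.
Implicit Types (u v : 'X_{1..n}) (m : mono n) (i j : 'I_n).

Lemma ratrvD u v : ratrv (u + v)%MM = ratrv u + ratrv v.
Proof. by apply/rowP => j; rewrite !mxE mnmDE natrD. Qed.

Lemma ratrvM k u : ratrv (u *+ k)%MM = k%:R *: ratrv u.
Proof. by apply/rowP => j; rewrite !mxE mulmnE natrM mulrC. Qed.

Lemma ratrv0 : ratrv (0%MM : 'X_{1..n}) = 0.
Proof. by apply/rowP => j; rewrite !mxE mnm0E. Qed.

Lemma ratrv_mrow i : ratrv (mrow A i) *m invmx (ratmx A) = delta_mx 0 i.
Proof.
have -> : ratrv (mrow A i) = row i (ratmx A) by apply/rowP => j; rewrite !mxE mnmE.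
by rewrite -row_mul mulmxV ?ratmx_unit // row1.
Qed.

Lemma mrow_neq0 i : mrow A i != 0%MM.
Proof.
apply/eqP => r0; have := ratrv_mrow i; rewrite r0 ratrv0 mul0mx => /rowP/(_ i)/eqP.
by rewrite !mxE !eqxx eq_sym oner_eq0.
Qed.

Definition cone u : Prop := forall i, 0 <= (ratrv u *m invmx (ratmx A)) 0 i.

(** The exponents in W_A and W_(pA) are r and p r for the rows r of A, and r A^-1 is a basis vector;
    the cone is a submonoid. *)
Lemma Z_cone (K : closedFieldType) p (pi : K) u : Z p pi A u != 0 -> cone u.
Proof.
apply: mexp_supp => [i|v w cv cw i|v].
- by rewrite ratrv0 mul0mx mxE.
- by rewrite ratrvD mulmxDl mxE addr_ge0.
have coneM k j i : 0 <= (ratrv (mrow A j *+ k)%MM *m invmx (ratmx A)) 0 i.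
  by rewrite ratrvM -scalemxAl ratrv_mrow !mxE mulr_ge0 // ler0n.
rewrite Z_mexp => /msupp_sum_le/flattenP[s /mapP[j _ ->]] /msuppZ_le /msuppB_le.
rewrite mem_cat mpolyXn !msuppX !inE => /orP[] /eqP -> i; first exact: coneM.
by rewrite -[mrow A j]mulm1n; exact: coneM.
Qed.

Lemma xwtE m : xwt A m = ratrv m.1 *m invmx (ratmx A).
Proof. by []. Qed.

Lemma ywtE m : ywt A m = ratrv m.2 *m invmx (ratmx A^T).
Proof. by rewrite /ywt ratmx_tr. Qed.

Lemma xywtE m : xywt A m = \sum_i (m.1 i)%:R * ywt A m 0 i.
Proof.
have -> : xywt A m = (ratrv m.1 *m (ywt A m)^T) 0 0.
  by rewrite /xywt /xwt /ywt trmx_mul -trmx_inv trmxK mulmxA.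
by rewrite mxE; apply: eq_bigr => i _; rewrite !mxE.
Qed.

Lemma xywtE' m : xywt A m = \sum_i xwt A m 0 i * (m.2 i)%:R.
Proof. by rewrite /xywt mxE; apply: eq_bigr => i _; rewrite !mxE. Qed.

End Weights.

Section WeightSets.
Variables (n : nat) (A : 'M[nat]_n).
Hypothesis detA : zdet A != 0.
Implicit Types (u v m : mono n) (i j : 'I_n).

Definition Ymono m : Prop := forall i, 0 <= ywt A m 0 i.
Definition Imono m : Prop := Ymono m /\ 0 < xywt A m.
Definition Smono m : Prop := Ymono m /\ forall i, 0 <= xwt A m 0 i.

Lemma xwtD u v : xwt A (shiftm u v) = xwt A u + xwt A v.
Proof. by rewrite /xwt ratrvD mulmxDl. Qed.

Lemma ywtD u v : ywt A (shiftm u v) = ywt A u + ywt A v.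
Proof. by rewrite /ywt ratrvD mulmxDl. Qed.

Definition scalem k m : mono n := ((m.1 *+ k)%MM, (m.2 *+ k)%MM).

Lemma xwtM k m : xwt A (scalem k m) = k%:R *: xwt A m.
Proof. by rewrite /xwt ratrvM scalemxAl. Qed.

Lemma ywtM k m : ywt A (scalem k m) = k%:R *: ywt A m.
Proof. by rewrite /ywt ratrvM scalemxAl. Qed.

Lemma Ymono_shift u m : Ymono u -> Ymono m -> Ymono (shiftm m u).
Proof. by move=> Yu Ym i; rewrite ywtD mxE addr_ge0. Qed.

(* The bilinear form g A^-1 l^T is nonnegative as soon as one argument lies in its cone. *)
Lemma Imono_shift u m : Ymono u -> (forall i, 0 <= xwt A u 0 i) ->
  Imono m -> Imono (shiftm m u).
Proof.
move=> Yu Xu [Ym m0]; split; first exact: Ymono_shift.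
have -> : xywt A (shiftm m u) = (xywt A m + \sum_i (m.1 i)%:R * ywt A u 0 i) +
    \sum_i xwt A u 0 i * ((m.2 i)%:R + (u.2 i)%:R).
  have -> : \sum_i xwt A u 0 i * ((m.2 i)%:R + (u.2 i)%:R) =
      \sum_i (u.1 i)%:R * ywt A (shiftm m u) 0 i.
    rewrite -[RHS](xywtE A (u.1, (shiftm m u).2)) xywtE'.
    by apply: eq_bigr => i _; rewrite /= mnmDE natrD.
  rewrite !xywtE -!big_split; apply: eq_bigr => i _ /=.
  by rewrite ywtD mxE mnmDE natrD; ring.
apply: ltr_wpDr; first by apply: sumr_ge0 => i _; rewrite mulr_ge0 ?addr_ge0.
by apply: ltr_wpDr => //; apply: sumr_ge0 => i _; rewrite mulr_ge0.
Qed.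

Lemma Smono_shift u m : Smono u -> Smono m -> Smono (shiftm m u).
Proof.
move=> [Yu Xu] [Ym Xm]; split; first exact: Ymono_shift.
by move=> i; rewrite xwtD mxE addr_ge0.
Qed.

Lemma Ymono_scale k m : Ymono m -> Ymono (scalem k m).
Proof. by move=> Ym i; rewrite ywtM mxE mulr_ge0 // ler0n. Qed.

Lemma Imono_scale k m : (0 < k)%N -> Imono m -> Imono (scalem k m).
Proof.
move=> k0 [Ym m0]; split; first exact: Ymono_scale.
have -> : xywt A (scalem k m) = k%:R * k%:R * xywt A m.
  rewrite !xywtE mulr_sumr; apply: eq_bigr => i _.
  by rewrite ywtM mxE mulmnE natrM; ring.
by rewrite !mulr_gt0 ?ltr0n.
Qed.

Lemma Smono_scale k m : Smono m -> Smono (scalem k m).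
Proof.
move=> [Ym Xm]; split; first exact: Ymono_scale.
by move=> i; rewrite xwtM mxE mulr_ge0 // ler0n.
Qed.

Lemma Smono_Z (K : closedFieldType) p (pi : K) u :
  Z p pi A u.1 != 0 -> Z p pi A^T u.2 != 0 -> Smono u.
Proof.
have detAT : zdet A^T != 0 by rewrite zdet_tr.
by move=> /(Z_cone detA) Xu /(Z_cone detAT) Yu; split=> // i; rewrite ywtE; exact: Yu.
Qed.

Lemma Smono_mrow i : Smono (mrow A i, 0%MM).
Proof.
split=> j; first by rewrite ywtE ratrv0 mul0mx mxE.
by rewrite xwtE ratrv_mrow // mxE; case: eqP; case: eqP.
Qed.

Lemma ywt_mrow i j : ywt A (0%MM, mrow A^T i) 0 j = (j == i)%:R.
Proof. by rewrite ywtE ratrv_mrow ?zdet_tr // mxE eqxx. Qed.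

Lemma Smono_mrow_tr i : Smono (0%MM, mrow A^T i).
Proof.
split=> j; last by rewrite xwtE ratrv0 mul0mx mxE.
by rewrite ywt_mrow; case: eqP.
Qed.

Lemma xwt_tr m : xwt A m = ywt A^T (m.2, m.1).
Proof. by rewrite ywtE trmxK. Qed.

Lemma ywt_tr m : ywt A m = xwt A^T (m.2, m.1).
Proof. by rewrite ywtE. Qed.

Lemma xywt_tr m : xywt A m = xywt A^T (m.2, m.1).
Proof. by rewrite xywtE xywtE' -ywt_tr; apply: eq_bigr => i _; rewrite mulrC. Qed.

End WeightSets.

(** * The chain map and the duality *)

Section DiagonalOperators.
Variables (p : nat) (K : closedFieldType) (n : nat).
Hypothesis K0 : [pchar K] =i pred0.
Implicit Types (A : 'M[nat]_n) (w : extp n (series n K)) (I : {set 'I_n}) (m : mono n).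

Definition scale_coef (d : {set 'I_n} -> mono n -> K) w : extp n (series n K) :=
  [ffun I : {set 'I_n} => (fun m => d I m * w I m) : series n K].

Lemma scale_coefE d w I m : scale_coef d w I m = d I m * w I m.
Proof. by rewrite ffunE. Qed.

Lemma extp_seriesP w w' : (forall I m, w I m = w' I m) -> w = w'.
Proof. by move=> E; apply/ffunP => I; apply: boolp.funext => m. Qed.

Lemma scale_coef_linear d : linear (scale_coef d).
Proof.
have lin c (X Y : extp n (series n K)) I m : (c *: X + Y) I m = c * X I m + Y I m.
  by rewrite extpD extpZ.
move=> c u v; apply: extp_seriesP => I m.
by rewrite [RHS]lin [LHS]scale_coefE lin !scale_coefE; ring.
Qed.

(** Reading one coordinate is a linear form that turns Q into multiplication by [q I m];
    [ppow_morph] then reduces to a single eigenvector in K. *)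
Lemma ppow_diag N (Q : extp n (series n K) -> extp n (series n K))
    (q : {set 'I_n} -> mono n -> int) w :
  (forall w I m, Q w I m = (q I m)%:~R * w I m) -> (forall I m, (`|q I m| <= N)%N) ->
  ppow p N Q w = scale_coef (fun I m => p%:R ^ q I m) w.
Proof.
move=> QE qN; apply: extp_seriesP => I m; pose f w : K^o := w I m.
have fL : linear f by move=> c u v; rewrite /f extpD extpZ.
have fQ v : f (Q v) = (q I m)%:~R *: f v by rewrite /f QE.
rewrite -[LHS]/(f (ppow p N Q w)) (ppow_morph p N w fL fQ) scale_coefE.
apply: (@ppow_eigen p N K K^o _ (q I m)) => // c x.
by rewrite !scalerA mulrC.
Qed.

Lemma extp_natmul w k I m : (w *+ k) I m = k%:R * w I m.
Proof. by rewrite -scaler_nat extpZ. Qed.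

(** The eigenvalue of [Qv] at x^g y^l e^I, since e_i^v e_i projects onto the sets I without i. *)
Definition yneg A I m : nat := #|[set i | (i \notin I) && (ywt A m 0 i != 0)]|.

Lemma QvE A w I m : Qv A w I m = (yneg A I m)%:R * w I m.
Proof.
rewrite /Qv extp_sum series_sum /yneg -sum1_card natr_sum mulr_suml big_mkcond [RHS]big_mkcond.
apply: eq_bigr => i _; rewrite /= !ffunE /Pv [X in _ = if X then _ else _]in_set; case: (boolP (i \in I)) => iI /=.
  by case: ifP.
rewrite setU11 setU1K // scalerA (esignD1 K i (setU11 i I)) ltnn mul1r setU1K //.
by rewrite -expr2 sqrr_sign scale1r mul1r; case: ifP.
Qed.

Lemma extdeg_coord w I m : extdeg w I m = (#|I|)%:R * w I m.
Proof. by rewrite extdegE. Qed.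

Lemma card_leq I : (#|I| <= n)%N.
Proof. by rewrite -[X in (_ <= X)%N]card_ord max_card. Qed.

Lemma yneg_leq A I m : (#|I| + yneg A I m <= n)%N.
Proof.
rewrite -[X in (_ <= X)%N]card_ord -(cardsC I) leq_add2l; apply: subset_leq_card.
by apply/subsetP => i; rewrite !inE => /andP[].
Qed.

Definition frdeg A I m : nat := (#|I| + 2 * yneg A I m)%N.

Lemma frdeg_leq A I m : (frdeg A I m <= 2 * n)%N.
Proof. by have := yneg_leq A I m; rewrite /frdeg; lia. Qed.

Lemma pexp_QA A w :
  pexp p (fun w => QA A w + Qv A w) w = scale_coef (fun I m => p%:R ^+ frdeg A I m) w.
Proof.
rewrite /pexp (ppow_diag (q := fun I m => frdeg A I m : int)) //; last first.
  by move=> I m; exact: frdeg_leq.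
move=> v J k; rewrite extpD seriesD /QA extpD seriesD QvE extdeg_coord.
by rewrite /frdeg -pmulrn natrD natrM; ring.
Qed.

Lemma frdeg_setU1 A I m i : i \notin I ->
  (frdeg A I m).+1 = (frdeg A (i |: I) m + 2 * (ywt A m 0%R i != 0%R))%N.
Proof.
move=> iI; rewrite /frdeg cardsU1 iI.
suff -> : yneg A I m = ((ywt A m 0%R i != 0%R) + yneg A (i |: I) m)%N by lia.
rewrite /yneg (cardsD1 i) inE iI /=; congr (_ + #|pred_of_set _|)%N.
by apply/setP => j; rewrite !inE negb_or; case: eqP.
Qed.

Lemma frdeg_ext A I m m' : m.2 = m'.2 -> frdeg A I m = frdeg A I m'.
Proof.
by move=> E; rewrite /frdeg /yneg; congr (_ + 2 * #|pred_of_set _|)%N; apply/setP => i; rewrite !inE /ywt E.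
Qed.

End DiagonalOperators.

Section ChainMap.
Variables (p : nat) (R : realType) (K : closedFieldType) (ord : K -> \bar R).
Hypotheses (p_prime : prime p) (Cp : is_Cp p ord).
Variables (n : nat) (pi : K).
Hypothesis pi_root : pi ^+ p.-1 = - p%:R.
Variable A : 'M[nat]_n.
Hypothesis detA : zdet A != 0.
Implicit Types (w : extp n (series n K)) (f g : series n K) (I : {set 'I_n}) (m : mono n) (i j : 'I_n).

Let K0 : [pchar K] =i pred0 := Cp_pchar0 Cp p_prime.
Let detAT : zdet A^T != 0. Proof. by rewrite zdet_tr. Qed.
Let A0 i : mrow A i != 0%MM. Proof. exact: mrow_neq0. Qed.
Let AT0 i : mrow A^T i != 0%MM. Proof. exact: mrow_neq0. Qed.

Lemma pi_neq0 : pi != 0.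
Proof.
apply/eqP => pi0; have := ord_root Cp p_prime pi_root.
by rewrite pi0; have [_ ->] := ord_eqy Cp 0.
Qed.

Lemma p_neq0 : p%:R != 0 :> K.
Proof. by rewrite ((pcharf0P K).1 K0) -lt0n prime_gt0. Qed.

Definition ext_on (S : mono n -> Prop) w : Prop := forall I, oc_on ord S (w I).

Lemma ext_onD S w w' : ext_on S w -> ext_on S w' -> ext_on S (w + w').
Proof. by move=> Sw Sw' I; rewrite extpD; exact: (oc_onD Cp). Qed.

Lemma ext_onZ S c w : ext_on S w -> ext_on S (c *: w).
Proof. by move=> Sw I; rewrite extpZ; exact: (oc_onZ Cp). Qed.

Lemma ext_on0 S : ext_on S 0.
Proof. by move=> I; rewrite extp0; exact: (oc_on0 Cp). Qed.

Lemma ext_on_sum S (T : Type) (s : seq T) (P : pred T) (F : T -> extp n (series n K)) :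
  (forall t, P t -> ext_on S (F t)) -> ext_on S (\sum_(t <- s | P t) F t).
Proof.
by move=> SF; elim/big_rec: _ => [|t f Pt]; [exact: ext_on0 | apply: ext_onD; exact: SF].
Qed.

Lemma ext_on_wedge S i w : ext_on S w -> ext_on S (wedge i w).
Proof. by move=> Sw I; rewrite ffunE; case: ifP => _; [exact: (oc_onZ Cp) | exact: (oc_on0 Cp)]. Qed.

Lemma ext_on_contract S i w : ext_on S w -> ext_on S (contract i w).
Proof. by move=> Sw I; rewrite ffunE; case: ifP => _; [exact: (oc_on0 Cp) | exact: (oc_onZ Cp)]. Qed.

Lemma ext_on_lift S S' T w : (forall f, oc_on ord S f -> oc_on ord S' (T f)) ->
  ext_on S w -> ext_on S' (lift T w).
Proof. by move=> ST Sw I; rewrite ffunE; exact: ST. Qed.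

Lemma ext_on_star (B : 'M[nat]_n) S w : ext_on S w -> ext_on S (star pi B w).
Proof.
move=> Sw; apply: ext_on_sum => I _.
have SE u i : ext_on S u -> ext_on S (bigE pi B^T i u).
  by move=> Su; apply/ext_onZ/ext_on_sum => j _; apply/ext_onZ/ext_on_wedge.
have SEv u i : ext_on S u -> ext_on S (bigEv pi B^T i u).
  by move=> Su; apply/ext_onZ/ext_on_sum => j _; apply/ext_onZ/ext_on_contract.
elim: (enum I) => /= [|i s IH]; last exact: SEv.
elim: (enum 'I_n) => /= [|i s IH]; last exact: SE.
by move=> J; rewrite ffunE; case: ifP => _ //; exact: (oc_on0 Cp).
Qed.

Lemma ext_on_pexp S w : ext_on S w -> ext_on S (pexp p (fun w => QA A w + Qv A w) w).
Proof.
move=> Sw I.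
rewrite (pexp_QA p K0) /scale_coef ffunE; apply: (oc_on_diag Cp (C := 0)) (Sw I) => m.
by rewrite oppr0 -natrX; exact: (vge_nat Cp).
Qed.

Lemma oc_on_theta_phi S i f : (forall u m, Smono A u -> S m -> S (shiftm m u)) ->
  oc_on ord S f -> oc_on ord S (theta i f + phi pi A i f).
Proof.
move=> SS Sf; apply: (oc_onD Cp).
  apply: (oc_on_diag Cp (C := 0)) Sf => m; rewrite oppr0; exact: (vge_nat Cp).
apply/(oc_onZ Cp)/(oc_on_sum Cp) => j _; apply/(oc_onZ Cp)/(oc_on_mshift Cp) => // m.
by apply: SS; exact: Smono_mrow.
Qed.

Lemma oc_on_Tv_psiv S i f : (forall u m, Smono A u -> S m -> S (shiftm m u)) ->
  oc_on ord S f -> oc_on ord S (Tv pi A i f + psiv A i f).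
Proof.
move=> SS Sf; apply: (oc_onD Cp).
  have [c _ cP] := vge_bound Cp (fun _ : unit => pi^-1).
  have [C _ CP] := vge_bound Cp (fun j => ratr (invmx (ratmx A^T) j i) : K).
  apply: (oc_on_diag Cp (C := c + C)) Sf => m; rewrite opprD (ratr_ywt K0).
  apply: (vgeM Cp) (cP tt) _; apply: (vge_sum Cp) => j _.
  by rewrite -[- C]add0r; apply: (vgeM Cp) (CP j); exact: (vge_nat Cp).
apply: (oc_on_mshift Cp) => // m.
by apply: SS; exact: Smono_mrow_tr.
Qed.

Lemma ext_on_dtot S w : (forall u m, Smono A u -> S m -> S (shiftm m u)) ->
  ext_on S w -> ext_on S (dtot pi A w).
Proof.
move=> SS Sw; apply: ext_onD; apply: ext_on_sum => i _.
  by apply: ext_on_lift (ext_on_wedge _ Sw) => f; exact: oc_on_theta_phi.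
by apply: ext_on_lift (ext_on_contract _ Sw) => f; exact: oc_on_Tv_psiv.
Qed.

Lemma oc_on_Frobenius S f : (forall u m, Smono A u -> S m -> S (shiftm m u)) ->
  (forall m, S m -> S (scalem p m)) -> oc_on ord S f -> oc_on ord S (Theta p pi A f).
Proof.
move=> SS Sp; apply: (oc_on_Theta p_prime Cp pi_root) => // m u Sm Zu Zv.
by apply: SS (Sp _ Sm); exact: (Smono_Z detA Zu Zv).
Qed.

Lemma ext_on_Fr S w : (forall u m, Smono A u -> S m -> S (shiftm m u)) ->
  (forall m, S m -> S (scalem p m)) -> ext_on S w -> ext_on S (Fr p pi A w).
Proof. by move=> SS Sp Sw; apply: ext_on_lift (ext_on_pexp Sw) => f; exact: oc_on_Frobenius. Qed.

Lemma pexp_QA_linear : linear (pexp (K := K) (n := n) p (fun w => QA A w + Qv A w)).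
Proof.
by move=> c u v; rewrite !(pexp_QA p K0); exact: scale_coef_linear.
Qed.

Lemma Fr_linear : linear (Fr p pi A).
Proof.
move=> c u v; rewrite /Fr (pexp_QA_linear c u v).
exact: (lift_linear (Theta_linear p pi A)).
Qed.

Lemma diag_linear (d : mono n -> K) : linear (fun (f : series n K) m => d m * f m : K^o).
Proof.
move=> c f g; apply: boolp.funext => m; rewrite [RHS]seriesD seriesZ seriesD seriesZ.
by ring.
Qed.

Lemma mshift_linear u : linear (@mshift K n u).
Proof.
move=> c f g; apply: boolp.funext => m; rewrite seriesD seriesZ /mshift.
by case: ifP => _; rewrite ?seriesD ?seriesZ ?mulr0 ?addr0.
Qed.

Lemma theta_phi_linear i : linear (fun f => theta i f + phi pi A i f).
Proof.
apply: linear_addf; first exact: (diag_linear (fun m => (m.1 i)%:R)).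
apply: (@linear_scaled _ _ _ _ (fun f => \sum_j (A j i)%:R *: mshift (mrow A j, 0%MM) f)).
apply: (@linear_comb_sum _ _ _ _ _ _ (fun j f => (A j i)%:R *: mshift (mrow A j, 0%MM) f)) => j.
exact/linear_scaled/mshift_linear.
Qed.

Lemma Tv_psiv_linear i : linear (fun f => Tv pi A i f + psiv A i f).
Proof.
apply: linear_addf; last exact: mshift_linear.
exact: (diag_linear (fun m => pi^-1 * ratr (ywt A m 0 i))).
Qed.

Lemma dtot_linear : linear (dtot pi A).
Proof.
apply: linear_addf.
  apply: (@linear_comb_sum _ _ _ _ _ _ (fun i w => lift (fun f => theta i f + phi pi A i f) (wedge i w))) => i.
  by apply: linear_comp (wedge_linear i); apply/lift_linear/theta_phi_linear.
apply: (@linear_comb_sum _ _ _ _ _ _ (fun i w => lift (fun f => Tv pi A i f + psiv A i f) (contract i w))) => i.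
by apply: linear_comp (contract_linear i); apply/lift_linear/Tv_psiv_linear.
Qed.

(** Both differentials pick up the same factor p, which is why one power of p can correct their
    sum. *)
Lemma dtot_Theta w :
  dtot pi A (lift (Theta p pi A) w) = p%:R *: lift (Theta p pi A) (dtot pi A w).
Proof.
have LT := Theta_linear p pi A; have LL := lift_linear (n := n) LT.
rewrite /dtot (linear_add LL) scalerDr /dA /dAv !(linear_bigsum LL) !scaler_sumr.
congr (_ + _); apply: eq_bigr => i _.
  rewrite -(lift_wedge LT); apply/ffunP => I; rewrite extpZ !ffunE.
  by rewrite (theta_phi_Theta pi p_prime K0 A0).
rewrite -(lift_contract LT); apply/ffunP => I; rewrite extpZ !ffunE.
by rewrite (Tv_psiv_Theta p_prime K0 pi_neq0 _ _ detA AT0).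
Qed.

(** Only exponents of x are moved. For fixed I, the factor p to the power [frdeg] is such a scalar,
    as [ywt] sees y alone. *)
Lemma theta_phi_diag (d : 'X_{1..n} -> K) i f m :
  (theta i (fun m => d m.2 * f m : K^o) + phi pi A i (fun m => d m.2 * f m : K^o)) m =
  d m.2 * (theta i f + phi pi A i f) m.
Proof.
rewrite !seriesD /phi !seriesZ !series_sum mulrDr; congr (_ + _); first by rewrite /theta mulrCA.
rewrite mulrCA [d _ * _]mulr_sumr; congr (_ * _); apply: eq_bigr => j _.
rewrite !seriesZ !mshiftx /shift mulrCA; case: ifP => //= _.
by rewrite !mulr0.
Qed.

(** A row j whose shift reaches an exponent with i-th entry 0 has A_ji = 0, and A_ji is the
    coefficient of that shift. *)
Lemma theta_phi_vanish i f m : m.1 i = 0%N -> (theta i f + phi pi A i f) m = 0.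
Proof.
move=> m0; rewrite seriesD /theta m0 mul0r add0r /phi seriesZ series_sum big1 ?mulr0 // => j _.
rewrite seriesZ mshiftx /shift; case: ifP => [/mnm_lepP/(_ i)|_]; last by rewrite mulr0.
by rewrite m0 mnmE leqn0 => /eqP ->; rewrite mul0r.
Qed.

Lemma Imono_pos i m : Ymono A m -> ywt A m 0 i != 0 -> m.1 i != 0%N -> 0 < xywt A m.
Proof.
move=> Ym yi mi; rewrite xywtE (bigD1 i) //=; apply: ltr_wpDr.
  by apply: sumr_ge0 => j _; rewrite mulr_ge0.
by rewrite mulr_gt0 ?ltr0n ?lt0n // lt_def yi Ym.
Qed.

(* (theta + phi) e_i raises frdeg by one where ywt i = 0 and lands in the ideal
   elsewhere; (Tv + psiv) e_i^v always raises it by one. *)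
Lemma pexp_dtot w : ext_on (Ymono A) w ->
  ext_on (Imono A) (pexp p (fun w => QA A w + Qv A w) (dtot pi A w) -
    p%:R *: dtot pi A (pexp p (fun w => QA A w + Qv A w) w)).
Proof.
set Pi := pexp p _ => Yw; set D := _ - _.
have YD : ext_on (Ymono A) D.
  have SS u m : Smono A u -> Ymono A m -> Ymono A (shiftm m u) by case=> ? _; exact: Ymono_shift.
  rewrite /D -scaleN1r; apply: ext_onD; first exact/ext_on_pexp/ext_on_dtot.
  by apply/ext_onZ/ext_onZ/ext_on_dtot/ext_on_pexp.
move=> I; have [YDI oD] := YD I; split=> // m DN0; split; first exact: YDI.
have Ym := YDI m DN0.
(* By contraposition: where g A^-1 l^T <= 0, every product g_i ywt_i is 0, and the coefficient at m
   is shown to vanish. *)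
apply: contra_neqT DN0 => xym; rewrite -leNgt in xym *.
have dE v : dtot pi A v I m =
    \sum_(i in I) esign K i I * (theta i (v (I :\ i)) + phi pi A i (v (I :\ i))) m +
    \sum_(i | i \notin I) esign K i I * (Tv pi A i (v (i |: I)) + psiv A i (v (i |: I))) m.
  rewrite /dtot extpD seriesD !extp_sum !series_sum; congr (_ + _).
    rewrite (bigID (fun i => i \in I)) /= [X in _ + X]big1 ?addr0 => [|i iI].
      apply: eq_bigr => i iI; rewrite !ffunE iI.
      by rewrite (linear_scale (theta_phi_linear i)).
    by rewrite !ffunE (negPf iI) (linear_0 (theta_phi_linear i)).
  rewrite (bigID (fun i => i \in I)) /= [X in X + _]big1 ?add0r => [|i iI].
    apply: eq_bigr => i iI; rewrite !ffunE (negPf iI).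
    by rewrite (linear_scale (Tv_psiv_linear i)).
  by rewrite !ffunE iI (linear_0 (Tv_psiv_linear i)).
have PE J : Pi w J = (fun m => p%:R ^+ frdeg A J m * w J m).
  by rewrite /Pi (pexp_QA p K0) /scale_coef ffunE.
have subE c (X Y : extp n (series n K)) : (X - c *: Y) I m = X I m - c * Y I m.
  by rewrite extpD extpN extpZ.
have PiE v : Pi v I m = p%:R ^+ frdeg A I m * v I m by rewrite /Pi (pexp_QA p K0) scale_coefE.
rewrite [LHS]subE PiE !dE.
apply/eqP; rewrite subr_eq0; apply/eqP.
rewrite !mulrDr !mulr_sumr; congr (_ + _); apply: eq_bigr => i iI.
  rewrite PE mulrCA [RHS]mulrCA; congr (_ * _).
  have -> : (fun m => p%:R ^+ frdeg A (I :\ i) m * w (I :\ i) m : K^o) =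
      (fun m => p%:R ^+ frdeg A (I :\ i) (0%MM, m.2) * w (I :\ i) m : K^o).
    by apply: boolp.funext => k; rewrite (@frdeg_ext _ A _ k (0%MM, k.2)).
  rewrite (theta_phi_diag (fun l => p%:R ^+ frdeg A (I :\ i) (0%MM, l))).
  rewrite -(@frdeg_ext _ A _ m (0%MM, m.2)) // mulrA -exprS.
  have [yi|yi] := eqVneq (ywt A m 0 i) 0.
    have iI' : i \notin I :\ i by rewrite setD11.
    by rewrite (frdeg_setU1 _ _ iI') setD1K // yi eqxx addn0.
  have mi : m.1 i = 0%N.
    by apply/eqP; apply: contraTT xym => mi; rewrite -ltNge (Imono_pos Ym yi mi).
  by rewrite theta_phi_vanish // !mulr0.
rewrite PE mulrCA [RHS]mulrCA; congr (_ * _); rewrite !seriesD !mulrDr.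
have fE k : ywt A m 0 i != 0 -> yneg A (i |: I) k = yneg A (i |: I) m ->
    frdeg A I m = (frdeg A (i |: I) k).+1.
  move=> yi yE; have := frdeg_setU1 A m iI; rewrite yi.
  by rewrite {2}/frdeg -yE -/(frdeg A (i |: I) k); lia.
congr (_ + _).
  rewrite /Tv; have [yi|yi] := eqVneq (ywt A m 0 i) 0.
    by rewrite yi (ratr_nat0 K0 0) !(mulr0, mul0r).
  rewrite (fE m yi) // exprS; move: (ratr _) (p%:R ^+ _) => a b; ring.
rewrite /psiv /mshift /=; case: ifP => [/andP[_ rm]|_]; last by rewrite !mulr0.
set k := (_, _); rewrite mulrA -exprS.
(* Support in [Ymono] gives ywt_i >= 0 at k; [psiv] adds 1 to it and leaves the other weights alone,
   so ywt_i > 0 at m and [fE] applies. *)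
have [w0|/(proj1 (Yw (i |: I)) k) Yk] := eqVneq (w (i |: I) k) 0; first by rewrite w0 !mulr0.
have mE : m = shiftm k (0%MM, mrow A^T i).
  by rewrite /shiftm /k /= subm0 addm0 (submK rm); exact: surjective_pairing.
have ymE j : ywt A m 0 j = ywt A k 0 j + (j == i)%:R.
  by rewrite {1}mE ywtD mxE ywt_mrow.
rewrite (fE k) //; first by rewrite ymE eqxx gt_eqF // ltr_wpDl.
congr #|pred_of_set _|; apply/setP => j; rewrite !inE ymE.
by case: eqP => //= _; rewrite addr0.
Qed.

(** The factor p from [dtot_Theta] matches the one in [pexp_dtot]. The error left there lies in the
    ideal, which [Theta] preserves. *)
Lemma Fr_dtot w : ext_on (Ymono A) w ->
  ext_on (Imono A) (Fr p pi A (dtot pi A w) - dtot pi A (Fr p pi A w)).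
Proof.
move=> Yw; have LL := lift_linear (n := n) (Theta_linear p pi A).
rewrite [X in _ - X]dtot_Theta /Fr -(linear_scale LL) -(linear_sub LL).
apply: ext_on_lift (pexp_dtot Yw) => f; apply: oc_on_Frobenius => [u m [Yu Xu]|m].
  exact: Imono_shift.
by apply: Imono_scale; exact: prime_gt0.
Qed.

Lemma Delta_linear : linear (Delta pi A).
Proof.
move=> c u v; rewrite /Delta (lift_linear (@Dswap_linear K n) c u v).
exact: star_linear.
Qed.

Lemma Delta_Theta w :
  Delta pi A (lift (Theta p pi A) w) = lift (Theta p pi A^T) (Delta pi A w).
Proof.
rewrite /Delta (lift_star pi (Theta_linear p pi A^T)); congr (star pi A _).
by apply/ffunP => I; rewrite !ffunE Theta_Dswap.
Qed.

Lemma Delta_extdeg w : Delta pi A (extdeg w) = Delta pi A w *+ n - extdeg (Delta pi A w).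
Proof.
rewrite -(star_extdeg K0 pi_neq0 _ detA) /Delta; congr (star pi A _).
apply/ffunP => I; apply: boolp.funext => m; rewrite extdeg_coord !ffunE /Dswap.
by rewrite extdeg_coord.
Qed.

Lemma Delta_Qhat w : Delta pi A (Qhat pi A w) = Qv A^T (Delta pi A w).
Proof.
have LS := @Dswap_linear K n.
have LP i : linear (@Pv K n A^T i).
  by move=> c f g; apply: boolp.funext => m; rewrite seriesD seriesZ /Pv; case: ifP => _; rewrite ?seriesD ?seriesZ //; ring.
rewrite /Delta /Qhat /Qv (linear_bigsum (lift_linear LS)) (linear_bigsum (star_linear _ _)).
apply: eq_bigr => i _.
have -> : lift (@Dswap K n) (lift (Phat A i) (bigE pi A i (bigEv pi A i w))) =
    lift (Pv A^T i) (lift (@Dswap K n) (bigE pi A i (bigEv pi A i w))).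
  apply/ffunP => I; apply: boolp.funext => m; rewrite !ffunE /Dswap /Phat /Pv.
  by rewrite xwt_tr; case: (m).
rewrite -(lift_star pi (LP i)) (lift_bigE pi LS) (lift_bigEv pi LS).
by rewrite star_bigE ?star_bigEv // pi_neq0.
Qed.

(** After the common factor p^(2 Q_A^v), with I and [yneg] read on the target, the exponents are n -
    |I| on the left and (|I| + 2 yneg) + (n - 2 |I|) - 2 yneg on the right. *)
Lemma Delta_pexp w :
  Delta pi A (pexp p (fun w => QA A w + Qv A w) w) =
  pexp p (fun w => QA A^T w + Qv A^T w)
    (Delta pi A (pexp p (fun w => extdeg w *+ 2 - w *+ n)
      (pexp p (fun w => - (Qhat pi A w *+ 2))
        (pexp p (fun w => Qv A w *+ 2) w)))).
Proof.
have LD := Delta_linear.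
have natmulD v k : Delta pi A (v *+ k) = Delta pi A v *+ k.
  by rewrite -!scaler_nat (linear_scale LD).
set P3 := pexp p (fun w => Qv A w *+ 2) w; pose Y := Delta pi A P3.
have -> : pexp p (fun w => QA A w + Qv A w) w = pexp p (@extdeg n K (series n K)) P3.
  rewrite /P3 (pexp_QA p K0) /pexp.
  rewrite !(ppow_diag p K0 (Q := fun w => Qv A w *+ 2) (q := fun I m => (2 * yneg A I m)%N : int)); last 2 first.
  - by move=> v J k; rewrite extp_natmul QvE mulrA -natrM -pmulrn.
  - by move=> I m; have := yneg_leq A I m; lia.
  rewrite (ppow_diag p K0 (Q := @extdeg n K (series n K)) (q := fun I _ => #|I| : int)); last 2 first.
  - by move=> v J k; rewrite extdeg_coord pmulrn.
  - by move=> I m; have := card_leq I; lia.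
  by apply: extp_seriesP => I m; rewrite !scale_coefE mulrA /frdeg exprD.
have E1 : Delta pi A (pexp p (@extdeg n K (series n K)) P3) =
    scale_coef (fun I _ => p%:R ^ (n%:Z - #|I|%:Z)) Y.
  apply: etrans (ppow_morph p (2 * n) P3 LD (Q' := fun w => w *+ n - extdeg w) Delta_extdeg) _.
  apply: (ppow_diag p K0 (q := fun I _ => n%:Z - #|I|%:Z)) => [v J k|I m].
    rewrite extpD extpN seriesD seriesN extp_natmul extdeg_coord.
    by rewrite intrB -!pmulrn mulrBl.
  by have := card_leq I; lia.
have E2 X : Delta pi A (pexp p (fun w => extdeg w *+ 2 - w *+ n) X) =
    scale_coef (fun I _ => p%:R ^ (n%:Z - (2 * #|I|)%N%:Z)) (Delta pi A X).
  have QD v : Delta pi A (extdeg v *+ 2 - v *+ n) = Delta pi A v *+ n - extdeg (Delta pi A v) *+ 2.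
    rewrite (linear_sub LD) !natmulD Delta_extdeg mulrnBl [_ *+ n *+ 2]mulr2n.
    by rewrite addrAC addrK.
  apply: etrans (ppow_morph p (2 * n) X LD (Q' := fun w => w *+ n - extdeg w *+ 2) QD) _.
  apply: (ppow_diag p K0 (q := fun I _ => n%:Z - (2 * #|I|)%N%:Z)) => [v J k|I m].
    rewrite extpD extpN seriesD seriesN !extp_natmul extdeg_coord.
    by rewrite intrB -!pmulrn mulrBl natrM mulrA.
  by have := card_leq I; lia.
(* [Qhat] need not be diagonal in the basis e^I, but its transport [Qv A^T] is, so its power is
   evaluated after [Delta]. *)
have E3 X : Delta pi A (pexp p (fun w => - (Qhat pi A w *+ 2)) X) =
    scale_coef (fun I m => p%:R ^ (- (2 * yneg A^T I m)%N%:Z)) (Delta pi A X).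
  have QD v : Delta pi A (- (Qhat pi A v *+ 2)) = - (Qv A^T (Delta pi A v) *+ 2).
    by rewrite (linear_opp LD) natmulD Delta_Qhat.
  apply: etrans (ppow_morph p (2 * n) X LD (Q' := fun w => - (Qv A^T w *+ 2)) QD) _.
  apply: (ppow_diag p K0 (q := fun I m => - (2 * yneg A^T I m)%N%:Z)) => [v J k|I m].
    rewrite extpN seriesN extp_natmul QvE.
    by rewrite intrN -pmulrn natrM mulrA mulNr.
  by have := yneg_leq A^T I m; lia.
apply: etrans E1 _; apply: esym; apply: etrans (pexp_QA p K0 _ _) _.
apply: etrans (congr1 (scale_coef _) (etrans (E2 _) (congr1 (scale_coef _) (E3 _)))) _.
apply: extp_seriesP => I m; rewrite !scale_coefE !mulrA; congr (_ * _).
rewrite [p%:R ^+ _]exprnP -!expfzDr ?p_neq0 //; congr (_ ^ _).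
by rewrite /frdeg; lia.
Qed.

Lemma Delta_Fr w :
  Delta pi A (Fr p pi A w) =
  Fr p pi A^T
    (Delta pi A (pexp p (fun w => extdeg w *+ 2 - w *+ n)
      (pexp p (fun w => - (Qhat pi A w *+ 2))
        (pexp p (fun w => Qv A w *+ 2) w)))).
Proof. exact: etrans (Delta_Theta _) (congr1 (lift (Theta p pi A^T)) (Delta_pexp w)). Qed.

Lemma ext_on_Delta S w : ext_on S w -> ext_on (fun m => S (m.2, m.1)) (Delta pi A w).
Proof.
by move=> Sw; apply: ext_on_star; apply: ext_on_lift Sw => f; exact: (oc_on_Dswap Cp).
Qed.

End ChainMap.

(** Additivity reduces differences to single elements. The numerator condition stays beside the
    denominator one, because the duality exchanges the ideals only within the C complexes. *)
Lemma inducesP (V V' : zmodType) (X : subquotient V) (Y : subquotient V') (T : V -> V') :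
  (forall u v, T (u - v) = T u - T v) ->
  (forall u v, sq_num X u -> sq_num X v -> sq_num X (u - v)) ->
  (forall v, sq_num X v -> sq_num Y (T v)) ->
  (forall v, sq_num X v -> sq_den X v -> sq_den Y (T v)) -> induces X Y T.
Proof.
move=> TB XB TN TD; split=> // v v' Xv Xv' Dv; rewrite -TB; apply: TD => //.
exact: XB.
Qed.

Lemma RidealE (R : realType) (K : closedFieldType) (ord : K -> \bar R) n (A : 'M[nat]_n) f :
  Rideal ord A f <-> oc_on ord (Imono A) f.
Proof.
split=> [[[Yf fo] If]|[If fo]]; first by split=> // m fm; split; [exact: Yf | exact: If].
by split=> [|m /If[]//]; split=> // m /If[].
Qed.

Lemma StildeE (R : realType) (K : closedFieldType) (ord : K -> \bar R) n (A : 'M[nat]_n) f :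
  Stilde ord A f <-> oc_on ord (Smono A) f.
Proof.
split=> [[[Yf fo] If]|[If fo]]; first by split=> // m fm; split; [exact: Yf | exact: If].
by split=> [|m /If[]//]; split=> // m /If[].
Qed.

Theorem proposition9p4 (p : nat) (R : realType) (K : closedFieldType)
    (ord : K -> \bar R) (F : fieldType) (red : K -> F) (pi : K)
    (n : nat) (A : 'M[nat]_n)
    (p_prime : prime p)
    (K_Cp : is_Cp p ord)
    (F_residue : is_residue_field ord red)
    (pi_root : pi ^+ p.-1 = - p%:R)
    (A_BH : BH F A)
    (p_large : (`|zdet A| < p)%N) :
  [/\ induces (Bcx ord A) (Bcx ord A) (Fr p pi A),
      same_induced_map (Bcx ord A) (Bcx ord A)
        (fun w => Fr p pi A (dtot pi A w))
        (fun w => dtot pi A (Fr p pi A w)) &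
      same_induced_map (Ccx ord A) (Ccx ord A^T)
        (fun w => Delta pi A (Fr p pi A w))
        (fun w => Fr p pi A^T
           (Delta pi A
              (pexp p (fun w => extdeg w *+ 2 - w *+ n)
                 (pexp p (fun w => - (Qhat pi A w *+ 2))
                    (pexp p (fun w => Qv A w *+ 2) w)))))].
Proof.
have [detA _ _] := A_BH.
have denB B (w : extp n (series n K)) : (forall I, Rideal ord B (w I)) <-> ext_on ord (Imono B) w.
  by split=> H I; apply/RidealE; exact: H.
have numC B (w : extp n (series n K)) : (forall I, Stilde ord B (w I)) <-> ext_on ord (Smono B) w.
  by split=> H I; apply/StildeE; exact: H.
have ext_onB S (u v : extp n (series n K)) :
    ext_on ord S u -> ext_on ord S v -> ext_on ord S (u - v).
  by move=> Su Sv I; rewrite extpD extpN; exact: (oc_onB K_Cp).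
have YS u m : Smono A u -> Ymono A m -> Ymono A (shiftm m u).
  by case=> ? _; exact: Ymono_shift.
have IS u m : Smono A u -> Imono A m -> Imono A (shiftm m u).
  by case; exact: Imono_shift.
have FrL := Fr_linear p_prime K_Cp pi A.
have dL := dtot_linear pi A.
have FrY w : ext_on ord (Ymono A) w -> ext_on ord (Ymono A) (Fr p pi A w).
  by apply: ext_on_Fr => // m; exact: Ymono_scale.
have FrI w : ext_on ord (Imono A) w -> ext_on ord (Imono A) (Fr p pi A w).
  by apply: ext_on_Fr => // m; exact/Imono_scale/prime_gt0.
have FrS w : ext_on ord (Smono A) w -> ext_on ord (Smono A) (Fr p pi A w).
  by apply: ext_on_Fr => // [u m|m]; [exact: Smono_shift | exact: Smono_scale].
have dY w : ext_on ord (Ymono A) w -> ext_on ord (Ymono A) (dtot pi A w).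
  by apply: (ext_on_dtot p_prime K_Cp).
have dI w : ext_on ord (Imono A) w -> ext_on ord (Imono A) (dtot pi A w).
  by apply: (ext_on_dtot p_prime K_Cp).
split.
- apply: inducesP => [u v|||w _]; [exact: linear_sub|exact: ext_onB|exact: FrY|].
  by move=> /denB /FrI Iw; apply/denB.
- split.
  + apply: inducesP => [u v|||w _].
    * by rewrite (linear_sub dL) (linear_sub FrL).
    * exact: ext_onB.
    * by move=> w /dY /FrY.
    by move=> /denB /dI /FrI Iw; apply/denB.
  + apply: inducesP => [u v|||w _].
    * by rewrite (linear_sub FrL) (linear_sub dL).
    * exact: ext_onB.
    * by move=> w /FrY /dY.
    by move=> /denB /FrI /dI Iw; apply/denB.
  by move=> w Yw; apply/denB; exact: Fr_dtot.
have DL : linear (Delta pi A) by exact: Delta_linear.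
have swapS (w : extp n (series n K)) : ext_on ord (Smono A) w ->
    ext_on ord (Smono A^T) (Delta pi A w).
  move=> /(ext_on_Delta K_Cp pi A) Sw I; apply: oc_on_sub (Sw I) => m [Ym Xm].
  by split=> i; [have := Xm i; rewrite xwt_tr; case: (m)
                |have := Ym i; rewrite ywt_tr; case: (m)].
(* The ideal is exchanged only within the C complexes: its elements need not
   have nonnegative weights on the x side. *)
have swapI (w : extp n (series n K)) : ext_on ord (Smono A) w -> ext_on ord (Imono A) w ->
    ext_on ord (Imono A^T) (Delta pi A w).
  move=> /swapS Sw /(ext_on_Delta K_Cp pi A) Iw I; have [SwI _] := Sw I; have [IwI wo] := Iw I.
  split=> // m wN0; split; first by case: (SwI m wN0).
  by have [_] := IwI m wN0; rewrite xywt_tr; case: (m).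
have DFr w := Delta_Fr p_prime K_Cp pi_root detA w.
have indD : induces (Ccx ord A) (Ccx ord A^T) (fun w => Delta pi A (Fr p pi A w)).
  apply: inducesP => [u v|u v|w|w].
  - by rewrite (linear_sub FrL) (linear_sub DL).
  - by move=> /numC Su /numC Sv; apply/numC/ext_onB.
  - by move=> /numC /FrS /swapS Sw; apply/numC.
  by move=> /numC /[dup] /FrS FS Sw /denB /FrI FI; apply/denB/swapI.
split=> // [|v _ I]; last by rewrite /= -DFr subrr extp0; apply/RidealE/(oc_on0 K_Cp).
by rewrite (_ : (fun w => Fr p pi A^T _) = fun w => Delta pi A (Fr p pi A w)) //;
  apply: boolp.funext => w.
Qed.
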